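(* For any $a\in[0,\theta]$ and any integer $n\ge1$, $$\frac12 P_{m(n)}(\theta)\ \le\ \sup_{x,y\in[0,\theta]}\left|\gamma_{\theta,a}\left(T_\theta^n\in[0,x],\ s_{n,a}\in[0,y]\right)-\frac{\log(1+xy)}{\log(1+\theta^2)}\right|\ \le\ \frac{1}{(m+1)^n}.$$
   Context: Let $m\ge 1$ be an integer and let $\theta\in(0,1)$ be irrational with $\theta^2=1/m$. Define $\eta(x)=\lfloor 1/(x\theta)\rfloor$ for $x\in(0,\theta]$, $\eta(0)=\infty$, and $T_\theta:[0,\theta]\to[0,\theta]$ by $T_\theta(x)=\frac1x-\theta\,\eta(x)$ for $x\in(0,\theta]$, $T_\theta(0)=0$. The digits of $x$ are $a_n(x)=\eta(T_\theta^{n-1}(x))$, $n\ge1$; outside a countable set they are all finite integers $\ge m$. For $a\in[0,\theta]$ let $\gamma_{\theta,a}$ be the probability measure on the Borel sets of $[0,\theta]$ with distribution function $\gamma_{\theta,a}([0,x])=\frac{(a\theta+1)x}{(ax+1)\theta}$, $x\in[0,\theta]$. For $a\in[0,\theta]$ define functions $s_{n,a}$ on $[0,\theta]$ by $s_{0,a}=a$ and $s_{n,a}=\frac{1}{a_n\theta+s_{n-1,a}}$, $n\ge1$ (with value $0$ if $a_n=\infty$; this only matters on a null set). The expression $\gamma_{\theta,a}(T_\theta^n\in[0,x],\,s_{n,a}\in[0,y])$ is the $\gamma_{\theta,a}$-measure of the set of $t\in[0,\theta]$ with $T_\theta^n(t)\in[0,x]$ and $s_{n,a}(t)\in[0,y]$.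 For integers $i\ge m$ and $x\in[0,\theta]$ put $u_i(x)=\frac{1}{x+i\theta}$ and $P_i(x)=\frac{x\theta+1}{(x+i\theta)(x+(i+1)\theta)}$. For $n\ge2$ and $i_1,\dots,i_n\ge m$ put $u_{i_n\ldots i_1}=u_{i_n}\circ\cdots\circ u_{i_1}$ and $P_{i_1\ldots i_n}(x)=P_{i_1}(x)\,P_{i_2}(u_{i_1}(x))\cdots P_{i_n}(u_{i_{n-1}\ldots i_1}(x))$. Finally $P_{m(n)}$ denotes $P_{i_1\ldots i_n}$ with $i_1=\cdots=i_n=m$ (so $P_{m(1)}=P_m$). *)

(* Defs.v *)
From HB Require Import structures.
From mathcomp Require Import all_boot all_order all_algebra.
From mathcomp Require Import all_classical all_reals all_analysis.
From mathcomp Require Import lra.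
Set Implicit Arguments.
Unset Strict Implicit.
Unset Printing Implicit Defensive.
Import Order.TTheory GRing.Theory Num.Theory.
Import numFieldNormedType.Exports.
Local Open Scope classical_set_scope.
Local Open Scope ring_scope.

Section ThetaExpansion.
Context {R : realType}.
Implicit Types (theta a t x : R) (i n : nat) (w : seq nat).

(* [None] stands for the digit infinity, taken at 0.  All functions below are
   total on R but only meaningful on [0, theta]. *)
Definition eta theta x : option int :=
  if x == 0 then None else Some (Num.floor (1 / (x * theta))).

Definition gaussT theta x : R :=
  if eta theta x is Some k then 1 / x - theta * k%:~R else 0.

(* a_n(t), for n >= 1 *)
Definition digit theta n t : option int :=
  eta theta (iter n.-1 (gaussT theta) t).

Fixpoint sn theta a n t : R :=
  if n is n'.+1 then
    if digit theta n t is Some k then 1 / (k%:~R * theta + sn theta a n' t)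
    else 0
  else a.

(* gamma is the probability measure gamma_{theta,a}.  Measures on the Borel
   sets of [0, theta] are represented by Borel measures on R; the distribution
   function takes the value 1 at theta, so gamma is carried by [0, theta].
   Existence is [is_gamma_exists]; uniqueness is that of a measure with a given
   distribution function. *)
Definition is_gamma theta a (gamma : probability (measurableTypeR R) R) : Prop :=
  forall x, 0 <= x <= theta ->
    gamma `[0, x]%classic = (((a * theta + 1) * x) / ((a * x + 1) * theta))%:E.

Definition joint_event theta a n (x y : R) : set R :=
  [set t | [/\ 0 <= t <= theta,
               0 <= iter n (gaussT theta) t <= x &
               0 <= sn theta a n t <= y]].

Definition u_digit theta i x : R := 1 / (x + i%:R * theta).

Definition P_digit theta i x : R :=
  (x * theta + 1) / ((x + i%:R * theta) * (x + i.+1%:R * theta)).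

(* u_{i_k ... i_1} for the word [:: i_1; ...; i_k]: u_{i_1} is applied first *)
Definition u_word theta w x : R := foldl (fun z i => u_digit theta i z) x w.

(* P_{i_1 ... i_n} for the word [:: i_1; ...; i_n] *)
Definition P_word theta w x : R :=
  \prod_(k < size w) P_digit theta (nth 0%N w k) (u_word theta (take k w) x).

End ThetaExpansion.

Section GammaExists.
Context {R : realType} (theta a : R) (theta0 : 0 < theta) (a0 : 0 <= a).

Let c (x : R) : R := Num.max 0 (Num.min x theta).
Let F (x : R) : R := ((a * theta + 1) * c x) / ((a * c x + 1) * theta).

Let c_ge0 x : 0 <= c x.
Proof. by rewrite /c le_max lexx. Qed.

Let den_gt0 x : 0 < (a * c x + 1) * theta.
Proof. by rewrite mulr_gt0// ltr_wpDl// mulr_ge0. Qed.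

Let F_nd : nondecreasing F.
Proof.
move=> x y xy; have cxy : c x <= c y.
  rewrite /c ge_max le_max lexx/= le_max; apply/orP; right.
  by rewrite le_min !ge_min xy lexx orbT.
rewrite /F ler_pdivrMr// mulrAC ler_pdivlMr//.
have at0 : 0 <= (a * theta + 1) * theta.
  by rewrite mulr_ge0 ?(ltW theta0)// addr_ge0// mulr_ge0// ltW.
have := ler_wpM2l at0 cxy; lra.
Qed.

Let F_rc : right_continuous F.
Proof.
move=> x; apply: cvg_at_right_filter.
have cc : continuous c.
  move=> z; apply: (@continuous_max R R (cst 0) (idfun \min cst theta)).
    exact: cvg_cst.
  by apply: continuous_min; [exact: cvg_id|exact: cvg_cst].
apply: cvgM; first by apply: cvgM; [exact: cvg_cst|exact: cc].
apply: cvgV; first by rewrite gt_eqF.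
apply: cvgM; last exact: cvg_cst.
by apply: cvgD; [apply: cvgM; [exact: cvg_cst|exact: cc]|exact: cvg_cst].
Qed.

#[local] HB.instance Definition _ := isCumulative.Build R _ R F F_nd F_rc.

Let F_le0 x : x <= 0 -> F x = 0.
Proof.
move=> x0; rewrite /F /c; have -> : Num.max 0 (Num.min x theta) = 0.
  by apply/max_idPl; rewrite ge_min x0.
by rewrite mulr0 mul0r.
Qed.

Let F_ge x : theta <= x -> F x = 1.
Proof.
move=> tx; rewrite /F; have -> : c x = theta.
  by rewrite /c (min_idPr tx); apply/max_idPr/ltW.
by rewrite divff// gt_eqF// mulr_gt0// ltr_wpDl// mulr_ge0// ltW.
Qed.

Let F_Ny : F @ -oo --> (0 : R).
Proof.
apply: cvg_near_cst; near=> x; apply: F_le0; near: x.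
by apply: nbhs_ninfty_le; exact: num_real.
Unshelve. all: by end_near. Qed.

Let F_y : F @ +oo --> (1 : R).
Proof.
apply: cvg_near_cst; near=> x; apply: F_ge; near: x.
by apply: nbhs_pinfty_ge; exact: num_real.
Unshelve. all: by end_near. Qed.

#[local] HB.instance Definition _ :=
  isCumulativeBounded.Build R 0 1 F F_Ny F_y.

Let mu : probability (measurableTypeR R) R := lebesgue_stieltjes_measure F.

Let muE r : mu `]-oo, r]%classic = (F r)%:E.
Proof. by rewrite -(cdf_lebesgue_stieltjes_id F r) /cdf /distribution/=. Qed.

Lemma is_gamma_exists :
  exists gamma : probability (measurableTypeR R) R, is_gamma theta a gamma.
Proof.
exists mu => x /andP[x0 xt].
have <- : F x = ((a * theta + 1) * x) / ((a * x + 1) * theta).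
  by rewrite /F /c (min_idPl xt) (max_idPr x0).
rewrite -muE.
have mu0 : mu `]-oo, 0[%classic = 0%E.
  apply/eqP; rewrite -measure_le0; have <- : mu `]-oo, 0]%classic = 0%E.
    by rewrite muE F_le0.
  by apply: le_measure; rewrite ?inE// => z /=; rewrite !in_itv/=; exact: ltW.
have -> : `]-oo, x]%classic = `]-oo, 0[%classic `|` `[0, x]%classic :> set R.
  apply/seteqP; split=> z /=; rewrite !in_itv/=; last first.
    by case=> [/ltW z0|/andP[]//]; exact: le_trans x0.
  by move=> zx; have [z0|z0] := ltP z 0; [left|right; rewrite zx].
rewrite measureU//; first by rewrite -[LHS]add0e -mu0.
by apply/seteqP; split=> z //=; rewrite !in_itv/= => -[z0 /andP[]]; rewrite leNgt z0.
Qed.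

End GammaExists.

(* Main.v *)
Require Import Defs.
From HB Require Import structures.
From mathcomp Require Import all_boot all_order all_algebra.
From mathcomp Require Import all_classical all_reals all_analysis.
From mathcomp Require Import measurable_realfun ring lra.
Import Order.TTheory GRing.Theory Num.Theory.
Import numFieldNormedType.Exports.
Local Open Scope classical_set_scope.
Local Open Scope ring_scope.

Set Implicit Arguments.
Unset Strict Implicit.
Unset Printing Implicit Defensive.

(** Under [gamma_{theta,a}] the sequence [s_{n,a}] is a Markov chain started at
    [a]: from [s] it moves to [u_i(s)] with probability [P_i(s)], [i >= m], and
    given the first [n] digits the law of [T^n] is [gamma_{theta,s}] with
    [s = s_{n,a}].  Both facts are in [gamma_cylT], which computes the measure of
    a cylinder intersected with [{T^n <= x}] by induction on the digits.  Writing
    [U f(s) = sum_i P_i(s) f(u_i(s))] for the transition operator, they give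
    ([gamma_joint]) that the joint distribution function at [(x, y)] equals
    [(U^n f)(a)], where [f(s) = gamma_s([0, x])] for [s <= y] and [0] otherwise.

    Upper bound.  [U] maps monotone functions to functions monotone in the other
    direction and divides their oscillation by at least [m + 1]
    ([chainU_contract]).  Monotonicity holds because the digit law [P_i(s)]
    becomes stochastically larger and each [u_i(s)] smaller as [s] grows.  The
    factor comes from comparing the endpoints: [u_i(theta) = u_(i+1)(0)], so the
    two series [U f(0)] and [U f(theta)] run over the same points and differ only
    by the weight [P_m(0) = 1 / (m + 1)] at [theta] and the weights
    [P_i(theta) - P_(i+1)(0)], which also add up to [1 / (m + 1)].  As [f] is a
    difference of two nondecreasing functions whose oscillations add up to at
    most [1] ([below_variation]), [U^n f] oscillates by at most
    [1 / (m + 1)^n].  It remains to see that [ln (1 + x y) / ln (1 + theta^2)] is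
    an average of the values of [U^n f].  It is the mean of [U^n f] for the
    density [theta / ((1 + s theta) ln (1 + theta^2))] ([gaussE_iter_below]).
    This is proved by induction on [n] for all thresholds at once: [U f] is a
    countable sum of differences of functions of the same shape as [f], and the
    resulting series of logarithms telescopes.

    Lower bound.  [s_{n,a}] takes the value [u_{m...m}(a)] with probability at
    least [P_{m(n)}(a)], so the distribution function jumps there, whereas the
    limit is continuous in [y]; hence one of the two sides of the jump is at
    distance at least half of it from the limit.  Finally
    [P_{m(n)}(a) >= P_{m(n)}(theta)] because [P_{m(n)}] is nonincreasing, which is
    proved together with a Harnack-type bound on its rate of decrease
    ([P_word_nseqm_harnack]). *)


(** * Words of digits *)

Section Words.
Context {R : realType} (theta : R).

Lemma u_word_rcons w i s :
  u_word theta (rcons w i) s = u_digit theta i (u_word theta w s).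
Proof. by rewrite /u_word foldl_rcons. Qed.

Lemma P_word_rcons w i s :
  P_word theta (rcons w i) s = P_word theta w s * P_digit theta i (u_word theta w s).
Proof.
rewrite /P_word size_rcons big_ord_recr /= nth_rcons ltnn eqxx.
rewrite -cats1 take_cat ltnn subnn take0 cats0; congr (_ * _).
apply: eq_bigr => k _.
by rewrite nth_cat takel_cat ?ltn_ord// ltnW.
Qed.

Lemma P_word_cons w i s :
  P_word theta (i :: w) s = P_digit theta i s * P_word theta w (u_digit theta i s).
Proof. by rewrite /P_word /= big_ord_recl. Qed.

End Words.

(** * The law of one digit and the distribution functions of the gamma measures *)

Section Digits.
Context {R : realType} (m : nat) (theta : R).
Context (theta0 : 0 < theta) (m_theta2 : m%:R * theta ^+ 2 = 1).
Implicit Types (s x y z : R) (i : nat).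

(** The distribution function of [gamma_{theta,s}] on [[0, theta]]. *)
Definition gamma_cdf s x : R := ((s * theta + 1) * x) / ((s * x + 1) * theta).

Lemma m_gt0 : (0 < m)%N.
Proof. by case: m m_theta2 => //; rewrite mul0r => /esym/eqP; rewrite oner_eq0. Qed.

Lemma digit_scale i : (m <= i)%N -> 1 <= i%:R * theta ^+ 2.
Proof. by move=> mi; rewrite -[leLHS]m_theta2 ler_wpM2r ?sqr_ge0 ?ler_nat. Qed.

Lemma digit_theta_gt0 i : (m <= i)%N -> 0 < i%:R * theta.
Proof. by move=> mi; rewrite mulr_gt0// ltr0n (leq_trans m_gt0). Qed.

Lemma u_digit_itv i s : (m <= i)%N -> 0 <= s -> 0 < u_digit theta i s <= theta.
Proof.
move=> mi s0; have h := digit_scale mi; have p := digit_theta_gt0 mi.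
rewrite /u_digit divr_gt0 ?ltr_wpDl//= ler_pdivrMr ?ltr_wpDl//; nra.
Qed.

Lemma u_digit_anti i s y : (m <= i)%N -> 0 <= s -> s <= y ->
  u_digit theta i y <= u_digit theta i s.
Proof.
move=> mi s0 sy; have p := digit_theta_gt0 mi.
by rewrite /u_digit !div1r lef_pV2 ?posrE ?ltr_wpDl ?lerD2r// (le_trans s0).
Qed.

Lemma u_digitS i : u_digit theta i theta = u_digit theta i.+1 0.
Proof. by rewrite /u_digit -natr1; congr (_ / _); ring. Qed.

Lemma u_digitm : u_digit theta m 0 = theta.
Proof.
rewrite /u_digit add0r; have p := digit_theta_gt0 (leqnn m).
by apply: (mulIf (lt0r_neq0 p)); rewrite mulfVK ?lt0r_neq0// -[LHS]m_theta2; ring.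
Qed.

Lemma P_digit_ge0 i s : 0 <= s -> 0 <= P_digit theta i s.
Proof.
move=> s0; rewrite /P_digit divr_ge0// ?addr_ge0 ?mulr_ge0//; try exact: ltW.
all: by rewrite addr_ge0// mulr_ge0// ltW.
Qed.

(** The probability that the digit drawn from the law [P_.(s)] is at least [i]:
    the [P_i(s)] are its successive differences ([P_digitE]), which is what makes
    every sum over the digits telescope. *)
Definition digit_tail i s : R := (s * theta + 1) / (theta * (s + i%:R * theta)).

Lemma digit_tail_ge0 i s : 0 <= s -> 0 <= digit_tail i s.
Proof.
move=> s0; have t := ltW theta0.
by rewrite /digit_tail divr_ge0// ?mulr_ge0 ?addr_ge0 ?mulr_ge0.
Qed.

Lemma P_digitE i s : (m <= i)%N -> 0 <= s ->
  P_digit theta i s = digit_tail i s - digit_tail i.+1 s.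
Proof.
move=> mi s0; have p := digit_theta_gt0 mi.
have p1 := digit_theta_gt0 (leq_trans mi (leqnSn i)).
rewrite /P_digit /digit_tail -[i.+1%:R]natr1; rewrite -natr1 in p1.
field; rewrite (lt0r_neq0 theta0)/=; apply/andP; split; apply: lt0r_neq0; lra.
Qed.

Lemma digit_tail_m s : 0 <= s -> digit_tail m s = 1.
Proof.
move=> s0; rewrite /digit_tail; have -> : theta * (s + m%:R * theta) = s * theta + 1.
  by transitivity (s * theta + m%:R * theta ^+ 2); [ring|rewrite m_theta2].
by rewrite divff// lt0r_neq0// ltr_wpDl// mulr_ge0// ltW.
Qed.

(** The digits get stochastically larger as [s] grows; [i >= m] enters through
    [1 <= i theta^2]. *)
Lemma digit_tail_mono i s y : (m <= i)%N -> 0 <= s -> s <= y ->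
  digit_tail i s <= digit_tail i y.
Proof.
move=> mi s0 sy; have p := digit_theta_gt0 mi; have h := digit_scale mi.
rewrite /digit_tail ler_pdivrMr ?mulr_gt0 ?ltr_wpDl// mulrAC.
rewrite ler_pdivlMr ?mulr_gt0 ?ltr_wpDl// ?(le_trans s0)//.
rewrite -subr_ge0.
have -> : (y * theta + 1) * (theta * (s + i%:R * theta)) -
   (s * theta + 1) * (theta * (y + i%:R * theta)) =
   theta * ((y - s) * (i%:R * theta ^+ 2 - 1)) by ring.
by rewrite mulr_ge0 ?mulr_ge0 ?subr_ge0// ltW.
Qed.

Lemma digit_tail_cvg s : 0 <= s -> digit_tail (m + n) s @[n --> \oo] --> 0.
Proof.
move=> s0.
have h : forall n, 0 <= digit_tail (m + n) s <= (s * theta + 1) / theta ^+ 2 * n.+1%:R^-1.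
  move=> n; rewrite digit_tail_ge0//= /digit_tail.
  rewrite -mulrA -invfM ler_wpM2l ?addr_ge0 ?mulr_ge0 ?(ltW theta0)//.
  have p1 : 0 < (m + n)%:R * theta by apply: digit_theta_gt0; rewrite leq_addr.
  rewrite lef_pV2 ?posrE ?mulr_gt0 ?ltr_wpDl// ?ltr0n//.
  rewrite expr2 -mulrA ler_wpM2l ?(ltW theta0)//.
  have : n.+1%:R <= (m + n)%:R :> R by rewrite ler_nat -add1n leq_add2r m_gt0.
  by move=> h; have := ler_wpM2l (ltW theta0) h; lra.
apply: (@squeeze_cvgr _ _ _ _ (fun=> 0) (fun n => (s * theta + 1) / theta ^+ 2 * n.+1%:R^-1)).
- by apply: nearW => n; exact: h.
- exact: cvg_cst.
- rewrite -[X in _ --> X](mulr0 ((s * theta + 1) / theta ^+ 2)).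
  by apply: cvgM; [exact: cvg_cst|exact: cvg_harmonic].
Qed.

Lemma sum_P_digit s n : 0 <= s ->
  \sum_(0 <= i < n) P_digit theta (m + i) s = 1 - digit_tail (m + n) s.
Proof.
move=> s0; rewrite -(digit_tail_m s0).
under eq_bigr do rewrite P_digitE ?leq_addr//.
elim: n => [|n IH]; first by rewrite big_geq// addn0 subrr.
by rewrite big_nat_recr//= IH addnS; ring.
Qed.

Lemma P_digit0 i : (m <= i)%N -> P_digit theta i 0 = m%:R / (i%:R * i.+1%:R).
Proof.
move=> mi; have i0 : (0 < i)%N by rewrite (leq_trans m_gt0).
rewrite /P_digit mul0r !add0r -[X in X / _ = _]m_theta2 -natr1; field.
rewrite (lt0r_neq0 theta0) natr1 !pnatr_eq0; by case: (i) i0.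
Qed.

Lemma P_digit_theta i : (m <= i)%N ->
  P_digit theta i theta = m.+1%:R / (i.+1%:R * i.+2%:R).
Proof.
move=> mi; rewrite /P_digit.
have -> : theta + i%:R * theta = i.+1%:R * theta by rewrite -[i.+1%:R]natr1; ring.
have -> : theta + i.+1%:R * theta = i.+2%:R * theta by rewrite -[i.+2%:R]natr1; ring.
have -> : theta * theta + 1 = m.+1%:R * theta ^+ 2.
  by rewrite -natr1 mulrDl m_theta2; ring.
have i0 := ler0n R i; field; rewrite (lt0r_neq0 theta0)/=.
rewrite andbT.
by apply/andP; split; apply: lt0r_neq0; lra.
Qed.

(** The laws at the two endpoints nearly agree after the shift [u_i(theta) =
    u_(i+1)(0)]; the difference is what the contraction factor is made of. *)
Lemma P_digit_endpoints i : (m <= i)%N ->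
  P_digit theta i theta = P_digit theta i.+1 0 + 1 / (i.+1%:R * i.+2%:R).
Proof.
move=> mi; rewrite P_digit_theta// P_digit0 ?(leq_trans mi)//.
by rewrite -mulrDl natr1.
Qed.

Lemma P_digitm0 : P_digit theta m 0 = 1 / m.+1%:R.
Proof.
rewrite P_digit0//; have m0 : 0 < m%:R :> R by rewrite ltr0n m_gt0.
field; apply/andP; split; apply: lt0r_neq0; lra.
Qed.

Lemma gamma_cdf_ge0 s x : 0 <= s -> 0 <= x -> 0 <= gamma_cdf s x.
Proof.
move=> s0 x0; have t := ltW theta0.
by rewrite /gamma_cdf divr_ge0// !mulr_ge0// ?addr_ge0// mulr_ge0.
Qed.

Lemma gamma_cdf_theta s : 0 <= s -> gamma_cdf s theta = 1.
Proof.
move=> s0; rewrite /gamma_cdf divff// lt0r_neq0// mulr_gt0// ltr_wpDl// mulr_ge0//.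
exact: ltW.
Qed.

Lemma gamma_cdf_diff s x y : 0 <= s -> 0 <= x -> 0 <= y ->
  gamma_cdf s y - gamma_cdf s x =
  (s * theta + 1) / theta * (y - x) / ((s * x + 1) * (s * y + 1)).
Proof.
move=> s0 x0 y0; have sx : 0 < s * x + 1 by rewrite ltr_wpDl// mulr_ge0.
have sy : 0 < s * y + 1 by rewrite ltr_wpDl// mulr_ge0.
by rewrite /gamma_cdf; field; rewrite !lt0r_neq0.
Qed.

Lemma gamma_cdf_mono s x y : 0 <= s -> 0 <= x -> x <= y -> gamma_cdf s x <= gamma_cdf s y.
Proof.
move=> s0 x0 xy; have y0 := le_trans x0 xy; have t := ltW theta0.
rewrite -subr_ge0 gamma_cdf_diff// divr_ge0//.
  by rewrite mulr_ge0 ?subr_ge0// divr_ge0// addr_ge0// mulr_ge0.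
by rewrite mulr_ge0// addr_ge0// mulr_ge0.
Qed.

Lemma gamma_cdf_le1 s x : 0 <= s -> 0 <= x <= theta -> gamma_cdf s x <= 1.
Proof. by move=> s0 /andP[x0 xt]; rewrite -(gamma_cdf_theta s0); exact: gamma_cdf_mono. Qed.

Lemma gamma_cdf_lip s x y : 0 <= s -> 0 <= x -> x <= y ->
  gamma_cdf s y - gamma_cdf s x <= (s * theta + 1) / theta * (y - x).
Proof.
move=> s0 x0 xy; have y0 := le_trans x0 xy; rewrite gamma_cdf_diff//.
rewrite ler_pdivrMr ?mulr_gt0 ?ltr_wpDl ?mulr_ge0//.
have t := ltW theta0; rewrite ler_peMr//.
  by rewrite mulr_ge0 ?subr_ge0// divr_ge0// addr_ge0// mulr_ge0.
by rewrite -[leLHS]mulr1 ler_pM// lerDr mulr_ge0.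
Qed.

Lemma gamma_cdf_mono_l s r x : 0 <= s -> s <= r -> 0 <= x <= theta ->
  gamma_cdf s x <= gamma_cdf r x.
Proof.
move=> s0 sr /andP[x0 xt]; have r0 := le_trans s0 sr.
have sx : 0 < s * x + 1 by rewrite ltr_wpDl// mulr_ge0.
have rx : 0 < r * x + 1 by rewrite ltr_wpDl// mulr_ge0.
rewrite -subr_ge0 /gamma_cdf.
have -> : (r * theta + 1) * x / ((r * x + 1) * theta) -
   (s * theta + 1) * x / ((s * x + 1) * theta) =
   x * (r - s) * (theta - x) / ((r * x + 1) * (s * x + 1) * theta).
  by field; rewrite !lt0r_neq0.
by rewrite divr_ge0 ?mulr_ge0 ?subr_ge0// ltW.
Qed.

(** One step of the conditional law: among the points whose first digit is [i],
    those that the map sends to [[0, x]] form the interval from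
    [1 / (i theta + x)] to [1 / (i theta)]; their [gamma_s]-measure is that of the
    digit [i] times the measure of [[0, x]] for [gamma_{u_i(s)}]. *)
Lemma gamma_cdf_digit i s x : (m <= i)%N -> 0 <= s -> 0 <= x ->
  P_digit theta i s * gamma_cdf (u_digit theta i s) x =
  gamma_cdf s (1 / (i%:R * theta)) - gamma_cdf s (1 / (i%:R * theta + x)).
Proof.
move=> mi s0 x0; have p := digit_theta_gt0 mi.
have i0 : 0 < i%:R :> R by rewrite ltr0n (leq_trans m_gt0).
rewrite /P_digit /gamma_cdf /u_digit -natr1.
field; rewrite !andbA !(lt0r_neq0 theta0) (lt0r_neq0 i0)/= ?andbT.
by rewrite !lt0r_neq0//; nra.
Qed.

Lemma inv_digit_itv i x : (m <= i)%N -> 0 <= x ->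
  0 < 1 / (i%:R * theta + x) <= theta.
Proof. by move=> mi x0; rewrite addrC; exact: u_digit_itv. Qed.

End Digits.

(** * Two facts on series *)

Lemma nneseries_EFin {R : realType} (u : R^nat) (l : R) :
  series u @ \oo --> l -> (\sum_(i <oo) (u i)%:E = l%:E)%E.
Proof.
move=> ul; apply: cvg_lim => //.
rewrite (_ : (fun n => _) = EFin \o series u); last first.
  by apply/funext => n /=; rewrite sumEFin seriesEnat.
by apply/fine_cvgP; split; [exact: nearW|].
Qed.

(** Summation by parts: nonnegative partial sums stay nonnegative when the terms
    are weighted by a nonincreasing nonnegative sequence. *)
Lemma abel_sum_ge0 {R : realFieldType} (d v : nat -> R) n :
  (forall k, 0 <= \sum_(0 <= i < k) d i) ->
  (forall k, 0 <= v k) -> (forall k, v k.+1 <= v k) ->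
  0 <= \sum_(0 <= i < n) d i * v i.
Proof.
move=> D0 v0 vS.
apply: (@le_trans _ _ (v n * \sum_(0 <= i < n) d i)); first exact: mulr_ge0.
elim: n => [|n IH]; first by rewrite !big_geq// mulr0.
apply: (@le_trans _ _ (v n * \sum_(0 <= i < n.+1) d i)).
  exact: ler_wpM2r.
by rewrite !big_nat_recr//= mulrDr lerD// mulrC.
Qed.

(** * The transition operator of the chain and its contraction property *)

Section Operator.
Context {R : realType} (m : nat) (theta : R).
Context (theta0 : 0 < theta) (m_theta2 : m%:R * theta ^+ 2 = 1).
Implicit Types (f h : R -> R) (s r x y z : R) (i : nat).

(** The transition operator of the chain [s_{n,a}]: the expectation of [f] after
    one step from [s]. *)
Definition chainU f s : R :=
  fine (\sum_(i <oo)
    (P_digit theta (m + i) s * f (u_digit theta (m + i) s))%:E)%E.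

(** All functions to which the operator is applied take values in [[0, 1]] on
    [[0, theta]]; there the defining series converges, and the class is stable
    under the operator and under [f |-> 1 - f]. *)
Definition unit_valued f := forall s, 0 <= s <= theta -> 0 <= f s <= 1.

Let u_in i s : 0 <= s <= theta -> 0 <= u_digit theta (m + i) s <= theta.
Proof.
move=> /andP[s0 _].
by have /andP[/ltW-> ->] := u_digit_itv theta0 m_theta2 (leq_addr i m) s0.
Qed.

Let P0 i s : 0 <= s <= theta -> 0 <= P_digit theta (m + i) s.
Proof. by move=> /andP[s0 _]; exact: P_digit_ge0. Qed.

Lemma nneseries_P_digit s : 0 <= s ->
  (\sum_(i <oo) (P_digit theta (m + i) s)%:E = 1%:E)%E.
Proof.
move=> s0; apply: nneseries_EFin.
rewrite (_ : series _ = (fun n => 1 - digit_tail theta (m + n) s)); last first.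
  by apply/funext => n; rewrite seriesEnat/= (sum_P_digit theta0 m_theta2).
rewrite -[X in _ --> X]subr0; apply: cvgB; first exact: cvg_cst.
exact: digit_tail_cvg.
Qed.

Let term_ge0 f i s : unit_valued f -> 0 <= s <= theta ->
  0 <= P_digit theta (m + i) s * f (u_digit theta (m + i) s).
Proof.
by move=> f1 ds; rewrite mulr_ge0 ?P0//; have /andP[] := f1 _ (u_in i ds).
Qed.

Let series_ge0 f s : unit_valued f -> 0 <= s <= theta ->
  (0 <= \sum_(i <oo)
    (P_digit theta (m + i) s * f (u_digit theta (m + i) s))%:E)%E.
Proof. by move=> f1 ds; apply: nneseries_ge0 => i _ _; rewrite lee_fin term_ge0. Qed.

Let series_le1 f s : unit_valued f -> 0 <= s <= theta ->
  (\sum_(i <oo)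
    (P_digit theta (m + i) s * f (u_digit theta (m + i) s))%:E <= 1%:E)%E.
Proof.
move=> f1 ds; have /andP[s0 _] := ds; rewrite -(nneseries_P_digit s0).
apply: lee_nneseries => i _; first by move=> _; rewrite lee_fin term_ge0.
by rewrite lee_fin ler_piMr ?P0//; have /andP[] := f1 _ (u_in i ds).
Qed.

Lemma chainUE f s : unit_valued f -> 0 <= s <= theta ->
  (chainU f s)%:E = (\sum_(i <oo)
    (P_digit theta (m + i) s * f (u_digit theta (m + i) s))%:E)%E.
Proof.
move=> f1 ds; rewrite fineK// fin_numE -ltey -ltNye.
rewrite (lt_le_trans _ (series_ge0 f1 ds)) ?ltNyr//=.
by rewrite (le_lt_trans (series_le1 f1 ds)) ?ltry.
Qed.

Lemma chainU_unit f : unit_valued f -> unit_valued (chainU f).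
Proof.
by move=> f1 s ds; rewrite -!lee_fin chainUE// series_ge0// series_le1.
Qed.

Lemma iter_chainU_unit n f : unit_valued f -> unit_valued (iter n chainU f).
Proof. by move=> f1; elim: n => //= n; exact: chainU_unit. Qed.

Lemma eq_chainU f h s : (forall r, 0 <= r <= theta -> f r = h r) ->
  0 <= s <= theta -> chainU f s = chainU h s.
Proof.
move=> fh ds; congr fine; apply: eq_eseriesr => i _.
by rewrite fh// u_in.
Qed.

Lemma eq_iter_chainU n f h s : (forall r, 0 <= r <= theta -> f r = h r) ->
  0 <= s <= theta -> iter n chainU f s = iter n chainU h s.
Proof.
by move=> fh; elim: n s => [|n IH] s ds /=; [exact: fh|exact: eq_chainU].
Qed.

Lemma chainU_cst1 s : 0 <= s <= theta -> chainU (fun=> 1) s = 1.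
Proof.
move=> ds; have /andP[s0 _] := ds; apply/EFin_inj; rewrite chainUE//.
  by rewrite -[RHS](nneseries_P_digit s0); apply: eq_eseriesr => i _; rewrite mulr1.
by move=> r _; rewrite ler01 lexx.
Qed.

Lemma chainUD f h s : unit_valued f -> unit_valued h -> unit_valued (f \+ h) ->
  0 <= s <= theta -> chainU (f \+ h) s = chainU f s + chainU h s.
Proof.
move=> f1 h1 fh1 ds; apply/EFin_inj; rewrite EFinD !chainUE//.
rewrite -nneseriesD; last 2 first.
- by move=> i _ _; rewrite lee_fin term_ge0.
- by move=> i _ _; rewrite lee_fin term_ge0.
by apply: eq_eseriesr => i _; rewrite -EFinD -mulrDr.
Qed.

Lemma iter_chainUD n f h s :
  unit_valued f -> unit_valued h -> unit_valued (f \+ h) -> 0 <= s <= theta ->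
  iter n chainU (f \+ h) s = iter n chainU f s + iter n chainU h s.
Proof.
move=> f1 h1 fh1; elim: n s => [|n IH] s ds //=.
have /= <- := @chainUD (iter n chainU f) (iter n chainU h) s.
- by apply: eq_chainU => // r dr; rewrite IH.
- exact: iter_chainU_unit.
- exact: iter_chainU_unit.
- by move=> r dr; rewrite /= -IH// (iter_chainU_unit n fh1).
- exact: ds.
Qed.

Lemma unit_valued_compl f : unit_valued f -> unit_valued (fun s => 1 - f s).
Proof. by move=> f1 s ds; have := f1 s ds; lra. Qed.

Lemma chainU_compl f s : unit_valued f -> 0 <= s <= theta ->
  chainU (fun s => 1 - f s) s = 1 - chainU f s.
Proof.
move=> f1 ds; have c1 := unit_valued_compl f1.
have := @chainUD f (fun s => 1 - f s) s f1 c1.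
have -> : f \+ (fun s => 1 - f s) = fun=> 1 by apply/funext => r; rewrite /= addrC subrK.
have u1 : unit_valued (fun=> 1) by move=> r _; rewrite ler01 lexx.
by rewrite chainU_cst1// => /(_ u1 ds) h; apply/esym/eqP; rewrite subr_eq addrC -h.
Qed.

(** Countable additivity of the iterates: interchange of two series of
    nonnegative terms. *)
Lemma iter_chainU_series n (h : nat -> R -> R) f s :
  (forall i, unit_valued (h i)) -> unit_valued f ->
  (forall r, 0 <= r <= theta -> (f r)%:E = (\sum_(i <oo) (h i r)%:E)%E) ->
  0 <= s <= theta ->
  (iter n chainU f s)%:E = (\sum_(i <oo) (iter n chainU (h i) s)%:E)%E.
Proof.
move=> h1 f1 fh; elim: n s => [|n IH] s ds /=; first exact: fh.
rewrite chainUE//; last exact: iter_chainU_unit.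
transitivity (\sum_(j <oo) \sum_(i <oo)
    (P_digit theta (m + j) s * iter n chainU (h i) (u_digit theta (m + j) s))%:E)%E.
  apply: eq_eseriesr => j _; rewrite EFinM IH ?u_in// -nneseriesZl//.
  by move=> i _; rewrite lee_fin; have /andP[] := iter_chainU_unit n (h1 i) (u_in j ds).
rewrite nneseries_interchange; last first.
  by move=> j i; rewrite lee_fin term_ge0//; exact: iter_chainU_unit.
by apply: eq_eseriesr => i _; rewrite chainUE//; exact: iter_chainU_unit.
Qed.

Definition incr_by f (d : R) := forall s r, 0 <= s -> s <= r -> r <= theta ->
  f s <= f r <= f s + d.

(** Increasing [s] moves every [u_i(s)] to the left and the digit law to larger
    digits, hence again to smaller values of [u_i]: both effects lower the mean
    of a nondecreasing function.  The second one is summation by parts against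
    the tails of the digit law. *)
Lemma chainU_anti f s r : unit_valued f ->
  (forall x y, 0 <= x -> x <= y -> y <= theta -> f x <= f y) ->
  0 <= s -> s <= r -> r <= theta -> chainU f r <= chainU f s.
Proof.
move=> f1 fm s0 sr rt; have ds : 0 <= s <= theta by rewrite s0 (le_trans sr).
have dr : 0 <= r <= theta by rewrite rt (le_trans s0).
rewrite -lee_fin !chainUE//; apply: lee_lim.
- by apply: is_cvg_nneseries => i _ _; rewrite lee_fin term_ge0.
- by apply: is_cvg_nneseries => i _ _; rewrite lee_fin term_ge0.
apply: nearW => n; rewrite !sumEFin lee_fin.
pose v i := f (u_digit theta (m + i) r).
apply: (@le_trans _ _ (\sum_(0 <= i < n) P_digit theta (m + i) s * v i)); last first.
  apply: ler_sum => i _; rewrite ler_wpM2l ?P0//.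
  have /andP[u0 _] := u_in i dr; have /andP[_ ut] := u_in i ds.
  by apply: fm => //; rewrite (u_digit_anti theta0 m_theta2) ?leq_addr.
rewrite -subr_ge0 -sumrB; under eq_bigr do rewrite -mulrBl.
apply: abel_sum_ge0 => k.
- have r0 := le_trans s0 sr; rewrite sumrB !(sum_P_digit theta0 m_theta2)//.
  have := digit_tail_mono theta0 m_theta2 (leq_addr k m) s0 sr; lra.
- by have /andP[] := f1 _ (u_in k dr).
- have /andP[u0 _] := u_in k.+1 dr; have /andP[_ ut] := u_in k dr.
  apply: fm => //; rewrite /u_digit !div1r.
  have p := digit_theta_gt0 theta0 m_theta2 (leq_addr k m).
  have p1 := digit_theta_gt0 theta0 m_theta2 (leq_addr k.+1 m).
  have r0 := le_trans s0 sr.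
  rewrite lef_pV2 ?posrE ?ltr_wpDl// lerD2l ler_wpM2r ?(ltW theta0)//.
  by rewrite ler_nat leq_add2l.
Qed.

Let w i : R := 1 / ((m + i).+1%:R * (m + i).+2%:R).
Let W f : \bar R := (\sum_(i <oo) (w i * f (u_digit theta (m + i) theta))%:E)%E.

Let theta_in : 0 <= theta <= theta. Proof. by rewrite lexx (ltW theta0). Qed.
Let zero_in : 0 <= (0 : R) <= theta. Proof. by rewrite lexx (ltW theta0). Qed.

(** The two series at the endpoints run over the points [u_i(theta) = u_(i+1)(0)];
    the term [i = m] at [0] has no partner and sits at [u_m(0) = theta]. *)
Let chainU_endpoints f : unit_valued f ->
  ((chainU f theta + f theta / m.+1%:R)%:E = (chainU f 0)%:E + W f)%E.
Proof.
move=> f1; have w0 i : 0 <= w i by rewrite /w divr_ge0.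
rewrite EFinD !chainUE// [X in _ = (X + _)%E]nneseries_recl//; last first.
  by move=> i _; rewrite lee_fin term_ge0.
rewrite addn0 (P_digitm0 theta0 m_theta2) (u_digitm theta0 m_theta2) mul1r.
rewrite addeC [f _ / _]mulrC -addeA; congr (_ + _)%E.
have -> : (\sum_(1 <= i <oo) (P_digit theta (m + i) 0 * f (u_digit theta (m + i) 0))%:E =
  \sum_(i <oo) (P_digit theta (m + i).+1 0 * f (u_digit theta (m + i) theta))%:E)%E.
  rewrite -[LHS](nneseries_addn (f := fun i => (P_digit theta (m + i) 0 *
    f (u_digit theta (m + i) 0))%:E) 1); last by move=> i; rewrite lee_fin term_ge0.
  by apply: eq_eseriesr => i _; rewrite addn1 addnS u_digitS.
rewrite /W -nneseriesD; last 2 first.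
- move=> i _ _; rewrite lee_fin mulr_ge0 ?P_digit_ge0//.
  by have /andP[] := f1 _ (u_in i theta_in).
- move=> i _ _; rewrite lee_fin mulr_ge0//.
  by have /andP[] := f1 _ (u_in i theta_in).
apply: eq_eseriesr => i _.
by rewrite -EFinD -mulrDl (P_digit_endpoints theta0 m_theta2) ?leq_addr.
Qed.

(** The weights [w] have total mass [1 / (m + 1)], by the endpoint identity for
    the constant function [1]; replacing [f] by its minimum [f 0] under them in
    the identity for [f] gives the factor. *)
Lemma chainU_contract f d : unit_valued f -> incr_by f d ->
  incr_by (fun s => 1 - chainU f s) (d / m.+1%:R).
Proof.
move=> f1 fd.
have anti : forall s r, 0 <= s -> s <= r -> r <= theta -> chainU f r <= chainU f s.
  by move=> s r; apply: chainU_anti => // x y x0 xy yt; have /andP[] := fd _ _ x0 xy yt.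
suff key : chainU f 0 - chainU f theta <= d / m.+1%:R.
  move=> s r s0 sr rt; have := anti _ _ s0 sr rt.
  have := anti _ _ (lexx 0) s0 (le_trans sr rt).
  have := anti _ _ (le_trans s0 sr) rt (lexx theta); move: key; set e := d / _; lra.
have W1 : (W (fun=> 1%R) = (m.+1%:R^-1)%:E)%E.
  have u1 : unit_valued (fun=> 1) by move=> r _; rewrite ler01 lexx.
  have := chainU_endpoints u1; rewrite !chainU_cst1// EFinD.
  by move=> /(congr1 (fun e => (e - 1%:E)%E)); rewrite addeAC subee// add0e
    [X in _ = X -> _]addeAC subee// add0e mul1r => <-.
have : ((f 0 / m.+1%:R)%:E <= W f)%E.
  rewrite EFinM -W1 /W -nneseriesZl; last first.
    by move=> i _; rewrite lee_fin mulr1 /w divr_ge0.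
  have /andP[f00 _] := f1 _ zero_in.
  apply: lee_nneseries => i _.
    by move=> _; rewrite -EFinM lee_fin mulr1 mulr_ge0// /w divr_ge0.
  rewrite -EFinM lee_fin mulr1 mulrC ler_wpM2l ?/w ?divr_ge0//.
  have /andP[u0 ut] := u_in i theta_in.
  by have /andP[] := fd _ _ (lexx 0) u0 ut.
have := chainU_endpoints f1; case: (W f) => [c| |] //=; rewrite -!EFinD.
move=> [e]; rewrite lee_fin => c0.
have /andP[_] := fd _ _ (lexx 0) (ltW theta0) (lexx theta).
have m0 : 0 <= m.+1%:R^-1 :> R by rewrite invr_ge0.
move=> /(ler_wpM2r m0); rewrite mulrDl; move: e c0; set q := m.+1%:R^-1; lra.
Qed.

(** As the direction of monotonicity alternates, the induction follows the
    function or its complement to [1]. *)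
Lemma iter_chainU_osc n f d s r : unit_valued f -> incr_by f d ->
  0 <= s <= theta -> 0 <= r <= theta ->
  `|iter n chainU f s - iter n chainU f r| <= d / m.+1%:R ^+ n.
Proof.
move=> f1 fd.
have [inc|inc] : incr_by (iter n chainU f) (d / m.+1%:R ^+ n) \/
    incr_by (fun s => 1 - iter n chainU f s) (d / m.+1%:R ^+ n).
- elim: n => [|n IH]; first by left; rewrite expr0 divr1.
  rewrite exprSr invfM mulrA; have un := iter_chainU_unit n f1.
  case: IH => IH; [right|left].
    exact: chainU_contract.
  have /= K := chainU_contract (unit_valued_compl un) IH.
  move=> x y x0 xy yt; have := K x y x0 xy yt.
  rewrite !chainU_compl//; [set e := _ / m.+1%:R; lra|..].
    by rewrite yt (le_trans x0).
  by rewrite x0 (le_trans xy).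
- move=> /andP[s0 st] /andP[r0 rt]; have [sr|/ltW rs] := leP s r.
    have := inc _ _ s0 sr rt; rewrite ler_norml; set e := d / _; lra.
  have := inc _ _ r0 rs st; rewrite ler_norml; set e := d / _; lra.
- move=> /andP[s0 st] /andP[r0 rt]; have [sr|/ltW rs] := leP s r.
    have := inc _ _ s0 sr rt; rewrite ler_norml; set e := d / _; lra.
  have := inc _ _ r0 rs st; rewrite ler_norml; set e := d / _; lra.
Qed.

Lemma measurable_u_digit i : (m <= i)%N ->
  measurable_fun `[0, theta] (u_digit theta i : R -> R).
Proof.
move=> mi; apply: subspace_continuous_measurable_fun => //.
apply/subspace_continuousP => x /=; rewrite in_itv/= => /andP[x0 _].
apply: cvg_within_filter; apply: cvgM; first exact: cvg_cst.
apply: cvgV; first by rewrite lt0r_neq0// ltr_wpDl// (digit_theta_gt0 theta0 m_theta2).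
by apply: cvgD; [exact: cvg_id|exact: cvg_cst].
Qed.

Lemma measurable_P_digit i : (m <= i)%N ->
  measurable_fun `[0, theta] (P_digit theta i : R -> R).
Proof.
move=> mi; apply: subspace_continuous_measurable_fun => //.
have p := digit_theta_gt0 theta0 m_theta2 mi.
have p1 := digit_theta_gt0 theta0 m_theta2 (leq_trans mi (leqnSn i)).
apply/subspace_continuousP => x /=; rewrite in_itv/= => /andP[x0 _].
apply: cvg_within_filter; apply: cvgM.
  by apply: cvgD; [apply: cvgM; [exact: cvg_id|exact: cvg_cst]|exact: cvg_cst].
apply: cvgV; first by rewrite lt0r_neq0// mulr_gt0 ?ltr_wpDl.
by apply: cvgM; apply: cvgD; (exact: cvg_id || exact: cvg_cst).
Qed.

Lemma measurable_chainU f : unit_valued f -> measurable_fun `[0, theta] f ->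
  measurable_fun `[0, theta] (chainU f).
Proof.
move=> f1 mf; apply/measurable_EFinP.
apply: (@eq_measurable_fun _ _ _ _ _ (fun s => \sum_(i <oo | i \in predT)
    (P_digit theta (m + i) s * f (u_digit theta (m + i) s))%:E)%E).
  by move=> s; rewrite inE/= in_itv/= => ds; rewrite chainUE.
apply: (@ge0_emeasurable_sum _ _ R _ (fun i s =>
    (P_digit theta (m + i) s * f (u_digit theta (m + i) s))%:E)).
  by move=> i s /=; rewrite in_itv/= => ds _; rewrite lee_fin term_ge0.
move=> i _; apply/measurable_EFinP; apply: measurable_funM.
  by apply: measurable_P_digit; rewrite leq_addr.
apply: (@measurable_comp _ _ _ _ _ _ `[0, theta]%classic) => //.
  by move=> _ [s /= ds <-]; move: ds; rewrite /= !in_itv/=; exact: u_in.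
by apply: measurable_u_digit; rewrite leq_addr.
Qed.

Lemma measurable_iter_chainU n f : unit_valued f -> measurable_fun `[0, theta] f ->
  measurable_fun `[0, theta] (iter n chainU f).
Proof.
move=> f1 mf; elim: n => //= n; apply: measurable_chainU.
exact: iter_chainU_unit.
Qed.

End Operator.

(** * The Gauss measure of the chain *)

Section Gauss.
Context {R : realType} (m : nat) (theta : R).
Context (theta0 : 0 < theta) (m_theta2 : m%:R * theta ^+ 2 = 1).
Implicit Types (f h : R -> R) (s r x y z c : R) (i : nat) (b : bool).

Let mu : measure (measurableTypeR R) R := @lebesgue_measure R.

Definition gauss_const : R := ln (1 + theta ^+ 2).
Definition gauss_density s : R := theta / ((1 + s * theta) * gauss_const).
(** Expectation for the stationary law of the chain. *)
Definition gaussE f : \bar R :=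
  (\int[mu]_(s in `[0%R, theta]) (f s * gauss_density s)%:E)%E.

(** The function [s |-> gamma_s([0, z])] cut at the threshold [c].  Both strict
    and large thresholds occur, since [u_i] reverses the order and turns the one
    into the complement of the other. *)
Definition below z b c s : R := if s < c ?<= if b then gamma_cdf theta s z else 0.
Definition above z b c s : R := if s < c ?<= if b then 0 else gamma_cdf theta s z.

Definition clamp c : R := Num.max 0 (Num.min c theta).
(** The limit distribution function, extended to all real thresholds [c]: those
    outside [[0, theta]] appear in the recursion. *)
Definition limit_cdf z c : R := ln (1 + z * clamp c) / gauss_const.

Lemma gauss_const_gt0 : 0 < gauss_const.
Proof. by rewrite ln_gt0// ltrDl exprn_gt0. Qed.

Lemma clamp_itv c : 0 <= clamp c <= theta.
Proof.
by rewrite /clamp le_max lexx/= ge_max ge_min lexx orbT (ltW theta0).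
Qed.

Lemma clamp_id c : 0 <= c <= theta -> clamp c = c.
Proof. by move=> /andP[c0 ct]; rewrite /clamp (min_idPl ct) (max_idPr c0). Qed.

Lemma gauss_density_ge0 s : 0 <= s -> 0 <= gauss_density s.
Proof.
move=> s0; have l := ltW gauss_const_gt0; have t := ltW theta0.
by rewrite /gauss_density divr_ge0// mulr_ge0// addr_ge0// mulr_ge0.
Qed.

Let measurable_ratio (u v : R -> R) : continuous u -> continuous v ->
  (forall s, 0 <= s -> v s != 0) -> measurable_fun `[0, theta] (fun s => u s / v s).
Proof.
move=> cu cv v0; apply: subspace_continuous_measurable_fun => //.
apply/subspace_continuousP => x /=; rewrite in_itv/= => /andP[x0 _].
apply: cvg_within_filter; apply: cvgM; first exact: cu.
by apply: cvgV; [exact: v0|exact: cv].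
Qed.

Lemma measurable_gauss_density : measurable_fun `[0, theta] gauss_density.
Proof.
apply: measurable_ratio.
- by move=> x; exact: cvg_cst.
- move=> x; apply: cvgM; last exact: cvg_cst.
  by apply: cvgD; [exact: cvg_cst|apply: cvgM; [exact: cvg_id|exact: cvg_cst]].
- move=> s s0; rewrite lt0r_neq0// mulr_gt0 ?gauss_const_gt0// ltr_wpDr// mulr_ge0//.
  exact: ltW.
Qed.

Lemma measurable_gamma_cdf z : 0 <= z -> measurable_fun `[0, theta] (gamma_cdf theta ^~ z).
Proof.
move=> z0; apply: measurable_ratio.
- move=> x; apply: cvgM; last exact: cvg_cst.
  by apply: cvgD; [apply: cvgM; [exact: cvg_id|exact: cvg_cst]|exact: cvg_cst].
- move=> x; apply: cvgM; last exact: cvg_cst.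
  by apply: cvgD; [apply: cvgM; [exact: cvg_id|exact: cvg_cst]|exact: cvg_cst].
- by move=> s s0; rewrite lt0r_neq0// mulr_gt0// ltr_wpDl// mulr_ge0.
Qed.

Let measurable_lteif b c : measurable_fun `[0, theta] (fun s : R => s < c ?<= if b).
Proof.
by case: b; rewrite /=; [apply: measurable_fun_ler|apply: measurable_fun_ltr].
Qed.

Lemma measurable_below z b c : 0 <= z -> measurable_fun `[0, theta] (below z b c).
Proof.
move=> z0; apply: measurable_fun_if => //.
by apply: measurable_funS (measurable_gamma_cdf z0) => //; exact: subIsetl.
Qed.

Lemma measurable_above z b c : 0 <= z -> measurable_fun `[0, theta] (above z b c).
Proof.
move=> z0; apply: measurable_fun_if => //.
by apply: measurable_funS (measurable_gamma_cdf z0) => //; exact: subIsetl.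
Qed.

Lemma below_unit z b c : 0 <= z <= theta -> unit_valued theta (below z b c).
Proof.
move=> dz s /andP[s0 st]; have /andP[z0 _] := dz; rewrite /below; case: ifP => _.
  by rewrite gamma_cdf_ge0// gamma_cdf_le1.
by rewrite lexx ler01.
Qed.

Lemma above_unit z b c : 0 <= z <= theta -> unit_valued theta (above z b c).
Proof.
move=> dz s /andP[s0 st]; have /andP[z0 _] := dz; rewrite /above; case: ifP => _.
  by rewrite lexx ler01.
by rewrite gamma_cdf_ge0// gamma_cdf_le1.
Qed.

Let measurable_gaussE f : measurable_fun `[0, theta] f ->
  measurable_fun `[0, theta] (fun s => (f s * gauss_density s)%:E).
Proof.
move=> mf; apply/measurable_EFinP; apply: measurable_funM => //.
exact: measurable_gauss_density.
Qed.

Lemma gaussED f h : unit_valued theta f -> unit_valued theta h ->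
  measurable_fun `[0, theta] f -> measurable_fun `[0, theta] h ->
  gaussE (f \+ h) = (gaussE f + gaussE h)%E.
Proof.
move=> f1 h1 mf mh; rewrite /gaussE -ge0_integralD//.
- by apply: eq_integral => s _; rewrite -EFinD mulrDl.
- move=> s /=; rewrite in_itv/= => ds; have /andP[f0 _] := f1 s ds.
  by rewrite lee_fin mulr_ge0// gauss_density_ge0//; case/andP: ds.
- exact: measurable_gaussE.
- move=> s /=; rewrite in_itv/= => ds; have /andP[f0 _] := h1 s ds.
  by rewrite lee_fin mulr_ge0// gauss_density_ge0//; case/andP: ds.
- exact: measurable_gaussE.
Qed.

Lemma eq_gaussE f h : (forall s, 0 <= s <= theta -> f s = h s) -> gaussE f = gaussE h.
Proof.
by move=> fh; apply: eq_integral => s; rewrite inE/= in_itv/= => ds; rewrite fh.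
Qed.

Let gauss_primitive z (k : R) : 0 <= z -> 0 <= k ->
  (\int[mu]_(s in `[0%R, k]) (z / ((1 + z * s) * gauss_const))%:E =
   (ln (1 + z * k) / gauss_const)%:E)%E.
Proof.
move=> z0; rewrite le_eqVlt => /predU1P[<-|k0].
  by rewrite set_itv1 integral_set1 mulr0 addr0 ln1 mul0r.
pose G s : R := ln (1 + z * s) / gauss_const.
have pos s : 0 <= s -> 0 < 1 + z * s by move=> s0; rewrite ltr_wpDr// mulr_ge0.
have cG s : 0 <= s -> G x @[x --> s] --> G s.
  move=> s0; apply: cvgM; last exact: cvg_cst.
  apply: continuous_cvg; first by apply: continuous_ln; exact: pos.
  by apply: cvgD; [exact: cvg_cst|apply: cvgM; [exact: cvg_cst|exact: cvg_id]].
have dG s : 0 <= s -> is_derive s 1 G (z / ((1 + z * s) * gauss_const)).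
  move=> s0; have := pos _ s0 => p.
  have h1 : is_derive s 1 (fun s => 1 + z * s) z.
    have := is_deriveD (is_derive_cst (1 : R) s 1) (is_deriveZ z (is_derive_id s (1 : R))).
    by rewrite add0r /GRing.scale/= mulr1.
  have h2 := @is_derive1_comp R (@ln R) _ s _ _ (is_derive1_ln p) h1.
  have h3 := is_deriveZ gauss_const^-1 h2.
  rewrite (_ : z / _ = gauss_const^-1 *: ((1 + z * s)^-1 * z)); last first.
    by rewrite invfM /GRing.scale/=; ring.
  rewrite (_ : G = gauss_const^-1 \*: (@ln R \o (fun s => 1 + z * s))) => //.
  by apply/funext => x; rewrite /G /= mulrC.
rewrite (@continuous_FTC2 _ _ G)//.
- by rewrite /G mulr0 addr0 ln1 mul0r sube0.
- apply/subspace_continuousP => x /=; rewrite in_itv/= => /andP[x0 _].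
  apply: cvg_within_filter; apply: cvgM; first exact: cvg_cst.
  apply: cvgV; first by rewrite lt0r_neq0// mulr_gt0 ?gauss_const_gt0// pos.
  apply: cvgM; last exact: cvg_cst.
  by apply: cvgD; [exact: cvg_cst|apply: cvgM; [exact: cvg_cst|exact: cvg_id]].
- split.
  + move=> x; rewrite in_itv/= => /andP[/ltW x0 _].
    by have [] := dG _ x0.
  + by apply: cvg_at_right_filter; exact: cG.
  + by apply: cvg_at_left_filter; apply: cG; exact: ltW.
- move=> x; rewrite in_itv/= => /andP[/ltW x0 _].
  by rewrite derive1E; have [_ ->] := dG _ x0.
Qed.

(** The density of the Gauss measure cancels the numerator of [gamma_s([0, z])],
    leaving [z / (1 + z s)] up to the constant.  The threshold is replaced by its
    clamped large version, which changes the integrand only at [0] and [c]. *)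
Lemma gaussE_below z b c : 0 <= z -> gaussE (below z b c) = (limit_cdf z c)%:E.
Proof.
move=> z0; have /andP[k0 kt] := clamp_itv c; rewrite /limit_cdf -gauss_primitive//.
transitivity (\int[mu]_(s in `[0%R, theta])
    (((fun s : R => (z / ((1 + z * s) * gauss_const))%:E) \_ `[0%R, clamp c]) s))%E; last first.
  rewrite -integral_mkcondl; congr integral; apply/seteqP; split => s /=.
    by case.
  by rewrite !in_itv/= => /andP[-> sk]; split => //; rewrite (le_trans sk).
apply: ae_eq_integral => //.
- by apply: measurable_gaussE; exact: measurable_below.
- apply/(measurable_restrict _ _ _) => //.
  apply: (@measurable_funS _ _ _ _ `[0, theta]%classic) => //.
  apply/measurable_EFinP; apply: measurable_ratio.
  + by move=> x; exact: cvg_cst.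
  + move=> x; apply: cvgM; last exact: cvg_cst.
    by apply: cvgD; [exact: cvg_cst|apply: cvgM; [exact: cvg_cst|exact: cvg_id]].
  + by move=> s s0; rewrite lt0r_neq0// mulr_gt0 ?gauss_const_gt0// ltr_wpDr// mulr_ge0.
exists [set 0; c]; split.
- by apply: measurableU; exact: measurable_set1.
- by apply: countable_lebesgue_measure0; exact: finite_set_countable.
move=> s /= /not_implyP[]; rewrite in_itv/= => /andP[s0 st] ne.
have [->|sn0] := eqVneq s 0; first by left.
have [->|snc] := eqVneq s c; first by right.
exfalso; apply: ne.
have {}s0 : 0 < s by rewrite lt_def sn0.
rewrite patchE mem_setE in_itv/= (ltW s0)/=.
have -> : (s <= clamp c) = (s < c).
  rewrite /clamp le_max leNgt s0/= le_min st andbT.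
  by rewrite le_eqVlt (negbTE snc).
have -> : below z b c s = if s < c then gamma_cdf theta s z else 0.
  by rewrite /below; case: (b); rewrite //= le_eqVlt (negbTE snc).
case: ifP => _; last by rewrite mul0r.
congr EFin; rewrite /gamma_cdf /gauss_density.
have l0 := gauss_const_gt0; have sz : 0 <= s * z by rewrite mulr_ge0// ltW.
have st0 : 0 < s * theta by rewrite mulr_gt0.
by field; rewrite !lt0r_neq0//; lra.
Qed.

Lemma clamp_theta : clamp theta = theta.
Proof. by rewrite clamp_id// lexx ltW. Qed.

Lemma below_total z s : s <= theta -> below z true theta s = gamma_cdf theta s z.
Proof. by move=> st; rewrite /below /= st. Qed.

Lemma gaussE_cst1 : gaussE (fun=> 1) = 1%E.
Proof.
rewrite (@eq_gaussE _ (below theta true theta)).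
  rewrite gaussE_below ?ltW// /limit_cdf clamp_theta -expr2 divff//.
  by rewrite lt0r_neq0// gauss_const_gt0.
by move=> s /andP[s0 st]; rewrite below_total// gamma_cdf_theta.
Qed.

End Gauss.

(** * Stationarity along the orbit of the test functions *)

Section Invariance.
Context {R : realType} (m : nat) (theta : R).
Context (theta0 : 0 < theta) (m_theta2 : m%:R * theta ^+ 2 = 1).
Implicit Types (f h : R -> R) (s r x y z c : R) (i : nat) (b : bool).

Notation U := (chainU m theta).

Definition log_ratio z (k : R) : R := ln (k + z) - ln k.

Lemma log_ratioE z (k : R) : 0 < k -> 0 <= z -> log_ratio z k = ln (1 + z / k).
Proof.
move=> k0 z0; rewrite /log_ratio -ln_div ?posrE ?ltr_wpDr//.
by rewrite mulrDl divff// lt0r_neq0.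
Qed.

Lemma limit_cdf_scaled z c (k : R) : 0 < k -> 0 <= z ->
  limit_cdf theta (1 / (k + z)) c = (ln (k + z + clamp theta c) - ln (k + z)) / gauss_const theta.
Proof.
move=> k0 z0; have /andP[c0 _] := clamp_itv theta0 c.
have kz : 0 < k + z by rewrite ltr_wpDr.
rewrite /limit_cdf -ln_div ?posrE ?ltr_wpDr//.
by congr (ln _ / _); field; rewrite lt0r_neq0.
Qed.

(** One term of the series of the recursion.  The point [i theta + clamp c] is
    [r] truncated to the interval from [i theta] to [(i + 1) theta], so the left
    side telescopes in [i]. *)
Lemma limit_cdf_digit i z r : (m <= i)%N -> 0 <= z ->
  let p := 1 / (i%:R * theta) in let q := 1 / (i%:R * theta + z) in
  let c := r - i%:R * theta in
  (limit_cdf theta p theta - limit_cdf theta p c) -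
    (limit_cdf theta q theta - limit_cdf theta q c) =
  (log_ratio z (Num.max r (i%:R * theta)) - log_ratio z (Num.max r (i.+1%:R * theta)))
    / gauss_const theta.
Proof.
move=> mi z0 /=; have k0 := digit_theta_gt0 theta0 m_theta2 mi.
rewrite -[in 1 / (i%:R * theta)](addr0 (i%:R * theta)) !limit_cdf_scaled//.
have -> : i.+1%:R * theta = i%:R * theta + theta by rewrite -natr1 mulrDl mul1r.
rewrite clamp_theta// addr0.
set k := i%:R * theta in k0 *; rewrite -!mulrBl; congr (_ / _).
rewrite /clamp /log_ratio.
have [rk|kr] := leP r k.
  have -> : Num.min (r - k) theta = r - k by apply/min_idPl; have t := theta0; lra.
  have -> : Num.max 0 (r - k) = 0 by apply/max_idPl; lra.
  have -> : Num.max r (k + theta) = k + theta by apply/max_idPr; have t := theta0; lra.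
  by rewrite !addr0 [k + theta + z]addrAC; ring.
have [rt|tr] := leP r (k + theta).
  have -> : Num.min (r - k) theta = r - k by apply/min_idPl; lra.
  have -> : Num.max 0 (r - k) = r - k by apply/max_idPr; lra.
  have -> : k + (r - k) = r by ring.
  have -> : k + z + (r - k) = r + z by ring.
  by rewrite [k + theta + z]addrAC; ring.
have -> : Num.min (r - k) theta = theta by apply/min_idPr; lra.
have -> : Num.max 0 theta = theta by apply/max_idPr; exact: ltW.
ring.
Qed.

Lemma log_ratio_sum c z : 0 < c -> 0 <= z ->
  series (fun i => (log_ratio z (Num.max c^-1 ((m + i)%:R * theta)) -
    log_ratio z (Num.max c^-1 ((m + i).+1%:R * theta))) / gauss_const theta) @ \oo -->
  limit_cdf theta z c.
Proof.
move=> c0 z0.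
pose v i := log_ratio z (Num.max c^-1 ((m + i)%:R * theta)).
have kpos i : 0 < Num.max c^-1 ((m + i)%:R * theta).
  by rewrite lt_max invr_gt0 c0.
have -> : limit_cdf theta z c = (v 0%N - 0) / gauss_const theta.
  rewrite /limit_cdf subr0 /v log_ratioE//; congr (ln (1 + z * _) / _).
  rewrite /clamp addn0; have t0 := theta0.
  have mt : m%:R * theta = theta^-1.
    apply: (mulIf (lt0r_neq0 theta0)); rewrite mulVf ?lt0r_neq0//.
    by rewrite -mulrA -expr2.
  have -> : Num.max 0 (Num.min c theta) = Num.min c theta.
    by apply/max_idPr; rewrite le_min !ltW.
  rewrite mt; have [ct|tc] := leP c theta.
    have -> : Num.max c^-1 theta^-1 = c^-1 by apply/max_idPl; rewrite lef_pV2 ?posrE.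
    by rewrite invrK.
  have -> : Num.max c^-1 theta^-1 = theta^-1.
    by apply/max_idPr; rewrite lef_pV2 ?posrE// ltW.
  by rewrite invrK.
rewrite (_ : series _ = fun n => (v 0%N - v n) / gauss_const theta); last first.
  apply/funext; elim=> [|n IH]; first by rewrite seriesEnat/= big_geq// subrr mul0r.
  by rewrite seriesSr IH /v addnS -mulrDl; congr (_ / _); ring.
apply: cvgM; last exact: cvg_cst.
apply: cvgB; first exact: cvg_cst.
apply: (@squeeze_cvgr _ _ _ _ (fun=> 0) (fun n => z / theta * n.+1%:R^-1)).
- apply: nearW => n; rewrite /v log_ratioE//.
  have zk : 0 <= z / Num.max c^-1 ((m + n)%:R * theta) by rewrite divr_ge0// ltW.
  rewrite ln_ge0 ?lerDl//=; apply: (le_trans (le_ln1Dx _)); first by lra.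
  rewrite -mulrA -invfM ler_wpM2l// lef_pV2 ?posrE ?mulr_gt0 ?ltr0n//.
  rewrite le_max; apply/orP; right; rewrite mulrC ler_wpM2r ?(ltW theta0)//.
  by rewrite ler_nat -add1n leq_add2r (m_gt0 m_theta2).
- exact: cvg_cst.
- rewrite -[X in _ --> X](mulr0 (z / theta)).
  by apply: cvgM; [exact: cvg_cst|exact: cvg_harmonic].
Qed.

Let digit_term z b c i s : R :=
  P_digit theta (m + i) s * below theta z b c (u_digit theta (m + i) s).

Let digit_term_unit z b c i : 0 <= z <= theta -> unit_valued theta (digit_term z b c i).
Proof.
move=> dz s ds; have /andP[s0 st] := ds; have /andP[z0 _] := dz.
have /andP[/ltW u0 ut] := u_digit_itv theta0 m_theta2 (leq_addr i m) s0.
have /andP[l0 l1] : 0 <= below theta z b c (u_digit theta (m + i) s) <= 1.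
  by apply: below_unit => //; rewrite u0.
have P0 := P_digit_ge0 theta0 (m + i) s0.
rewrite /digit_term mulr_ge0//= (le_trans (ler_piMr P0 l1))//.
rewrite (P_digitE theta0 m_theta2) ?leq_addr//.
have := digit_tail_ge0 theta0 (m + i).+1 s0.
have := digit_tail_m theta0 m_theta2 s0.
have : digit_tail theta (m + i) s <= digit_tail theta m s; last by lra.
have t := theta0; have p := digit_theta_gt0 theta0 m_theta2 (leqnn m).
have p1 := digit_theta_gt0 theta0 m_theta2 (leq_addr i m).
rewrite /digit_tail ler_wpM2l ?addr_ge0 ?mulr_ge0 ?(ltW t)//.
rewrite lef_pV2 ?posrE ?mulr_gt0 ?ltr_wpDl// ler_pM2l// lerD2l ler_wpM2r ?(ltW t)//.
by rewrite ler_nat leq_addr.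
Qed.

(** A term of [U (below z b c)] is the difference of two functions of the same
    kind with complementary threshold: [u_i(s) < c] means [1 / c - i theta < s],
    and [gamma_cdf_digit] splits the product. The equation is written without
    subtraction to stay within the unit-valued functions. *)
Let digit_termD z b c i s : 0 <= z <= theta -> 0 < c -> 0 <= s <= theta ->
  let k := (m + i)%:R * theta in
  above theta (1 / k) (~~ b) (c^-1 - k) s =
  digit_term z b c i s + above theta (1 / (k + z)) (~~ b) (c^-1 - k) s.
Proof.
move=> /andP[z0 _] c0 /andP[s0 st] /=.
have k0 := digit_theta_gt0 theta0 m_theta2 (leq_addr i m).
have -> : digit_term z b c i s = above theta (1 / ((m + i)%:R * theta)) (~~ b)
    (c^-1 - (m + i)%:R * theta) s -
  above theta (1 / ((m + i)%:R * theta + z)) (~~ b) (c^-1 - (m + i)%:R * theta) s;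
  last by rewrite subrK.
have sk : 0 < s + (m + i)%:R * theta by rewrite ltr_wpDl.
rewrite /digit_term /below /above.
have -> : (u_digit theta (m + i) s < c ?<= if b) =
    ~~ (s < c^-1 - (m + i)%:R * theta ?<= if ~~ b).
  rewrite -lteifNE /u_digit lteif_pdivrMr// lteifBlDr.
  by rewrite negbK -[c^-1]mulr1 lteif_pdivrMl.
case: (s < _ ?<= if _) => /=; first by rewrite mulr0 subrr.
by rewrite (gamma_cdf_digit theta0 m_theta2) ?leq_addr.
Qed.

(** The expectation of [U^n f] for the stationary law does not depend on [n].  The
    induction peels off the innermost application of [U], whose terms are again
    of the form covered by the induction hypothesis. *)
Lemma gaussE_iter_below n z b c : 0 <= z <= theta ->
  gaussE theta (iter n U (below theta z b c)) = (limit_cdf theta z c)%:E.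
Proof.
elim: n z b c => [|n IH] z b c dz; have /andP[z0 zt] := dz.
  exact: gaussE_below.
(* The two cuts add up to the uncut function, whose mean is known. *)
have IHabove y (x : bool) (d : R) : 0 <= y <= theta ->
    gaussE theta (iter n U (above theta y x d)) =
    (limit_cdf theta y theta - limit_cdf theta y d)%:E.
  move=> dy; have /andP[y0 _] := dy; have ub := below_unit theta0 x d dy.
  have ua := above_unit theta0 x d dy.
  have : gaussE theta (iter n U (below theta y true theta)) =
      gaussE theta (iter n U (below theta y x d) \+ iter n U (above theta y x d)).
    have ab : forall s, s <= theta ->
      below theta y true theta s = (below theta y x d \+ above theta y x d) s.
      move=> s st; rewrite below_total//= /below /above.
      by case: ifP; rewrite ?addr0 ?add0r.
    apply: eq_gaussE => s ds /=; rewrite -(iter_chainUD theta0 m_theta2)//.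
      by apply: (eq_iter_chainU theta0 m_theta2) => // r /andP[_]; exact: ab.
    by move=> r dr; rewrite -ab ?below_unit//; case/andP: dr.
  rewrite IH// (gaussED theta0); last 4 first.
  - exact: iter_chainU_unit.
  - exact: iter_chainU_unit.
  - by apply: measurable_iter_chainU => //; exact: measurable_below.
  - by apply: measurable_iter_chainU => //; exact: measurable_above.
  rewrite IH//; case: (gaussE _ _) => [e| |] //=; rewrite -EFinD => -[->].
  by rewrite addrAC subrr add0r.
rewrite iterSr; have [c0|c0] := leP c 0.
  (* [u_i] is positive, so the cut function vanishes after one step; as a test
     function [0] is [below] at [z = 0]. *)
  have -> : limit_cdf theta z c = limit_cdf theta 0 theta.
    rewrite /limit_cdf mul0r; have -> : clamp theta c = 0; last by rewrite mulr0.
    by apply/max_idPl; rewrite ge_min c0.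
  rewrite -(IH 0 true theta) ?lexx ?(ltW theta0)//; apply: eq_gaussE => s ds.
  apply: (eq_iter_chainU theta0 m_theta2) => // r /andP[r0 rt].
  rewrite below_total// /gamma_cdf mulr0 mul0r /chainU eseries0//= => i _ _.
  have /andP[u0 _] := u_digit_itv theta0 m_theta2 (leq_addr i m) r0.
  rewrite /below; case: ifP => [/lteifW uc|]; last by rewrite mulr0.
  by have := lt_le_trans u0 (le_trans uc c0); rewrite ltxx.
pose hn i s := iter n U (digit_term z b c i) s.
have k0 i := digit_theta_gt0 theta0 m_theta2 (leq_addr i m).
have mterm i : measurable_fun `[0, theta] (digit_term z b c i).
  apply: (@eq_measurable_fun _ _ _ _ _ (fun s =>
    above theta (1 / ((m + i)%:R * theta)) (~~ b) (c^-1 - (m + i)%:R * theta) s -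
    above theta (1 / ((m + i)%:R * theta + z)) (~~ b) (c^-1 - (m + i)%:R * theta) s)).
    move=> s; rewrite inE/= in_itv/= => ds.
    by have /= -> := digit_termD b i dz c0 ds; rewrite addrK.
  apply: measurable_funB; apply: measurable_above => //; rewrite divr_ge0//.
    exact: ltW.
  by rewrite addr_ge0// ltW.
have hE i : gaussE theta (hn i) =
    ((log_ratio z (Num.max c^-1 ((m + i)%:R * theta)) -
    log_ratio z (Num.max c^-1 ((m + i).+1%:R * theta))) / gauss_const theta)%:E.
  rewrite -(limit_cdf_digit _ (leq_addr i m))//.
  set p := 1 / _; set q := 1 / _; set d := c^-1 - _.
  have dp : 0 <= p <= theta.
    have /andP[/ltW p0 pt] := inv_digit_itv theta0 m_theta2 (leq_addr i m) (lexx 0).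
    by move: p0 pt; rewrite addr0 -/p => -> ->.
  have dq : 0 <= q <= theta.
    by have /andP[/ltW -> ->] := inv_digit_itv theta0 m_theta2 (leq_addr i m) z0.
  have uh : unit_valued theta (digit_term z b c i) by exact: digit_term_unit.
  have uq := above_unit theta0 (~~ b) d dq.
  have : gaussE theta (iter n U (above theta p (~~ b) d)) =
      gaussE theta (hn i \+ iter n U (above theta q (~~ b) d)).
    apply: eq_gaussE => s ds /=; rewrite -(iter_chainUD theta0 m_theta2)//.
      apply: (eq_iter_chainU theta0 m_theta2) => // r dr.
      exact: (digit_termD b i dz c0 dr).
    move=> r dr /=; have := above_unit theta0 (~~ b) d dp dr.
    by have /= <- := digit_termD b i dz c0 dr.
  rewrite IHabove// (gaussED theta0); last 4 first.
  - exact: iter_chainU_unit.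
  - exact: iter_chainU_unit.
  - by apply: measurable_iter_chainU.
  - apply: measurable_iter_chainU => //; apply: measurable_above => //.
    by case/andP: dq.
  rewrite IHabove//; case: (gaussE _ _) => [e| |] //=; rewrite -EFinD => -[->].
  by rewrite addrK.
have hn_ge0 i s : 0 <= s <= theta -> 0 <= hn i s.
  move=> ds; have /andP[] // : 0 <= hn i s <= 1.
  by apply: (iter_chainU_unit theta0 m_theta2 n (digit_term_unit b c i dz)).
transitivity (\sum_(i <oo) gaussE theta (hn i))%E; last first.
  rewrite -(nneseries_EFin (log_ratio_sum c0 z0)).
  by apply: eq_eseriesr => i _; rewrite hE.
rewrite /gaussE -integral_nneseries//.
- apply: eq_integral => s; rewrite inE/= in_itv/= => ds.
  rewrite EFinM (iter_chainU_series theta0 m_theta2 n (h := digit_term z b c))//.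
  + rewrite muleC -nneseriesZl; last by move=> i _; rewrite lee_fin; exact: hn_ge0.
    by apply: eq_eseriesr => i _; rewrite -EFinM mulrC.
  + by move=> i; exact: digit_term_unit.
  + by apply: chainU_unit => //; exact: below_unit.
  + by move=> r dr; rewrite chainUE//; exact: below_unit.
- move=> i; apply/measurable_EFinP; apply: measurable_funM.
    by apply: measurable_iter_chainU => //; exact: digit_term_unit.
  exact: measurable_gauss_density.
- move=> i s; rewrite /= in_itv/= => ds; rewrite lee_fin mulr_ge0 ?hn_ge0//.
  by rewrite gauss_density_ge0//; case/andP: ds.
Qed.

End Invariance.

(** * Cylinders and the joint law *)

Section Cylinders.
Context {R : realType} (m : nat) (theta a : R).
Context (theta0 : 0 < theta) (m_theta2 : m%:R * theta ^+ 2 = 1).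
Context (a_itv : 0 <= a <= theta).
Implicit Types (s t x y z c : R) (i : nat) (w : seq nat) (B : set R).

Notation T := (gaussT theta).
Notation U := (chainU m theta).
Notation admissible := (all (leq m)).

Lemma gaussT0 : T 0 = 0. Proof. by rewrite /gaussT /Defs.eta eqxx. Qed.

Lemma gaussT_itv z : 0 <= z <= theta -> 0 <= T z <= theta.
Proof.
move=> /andP[z0 zt]; rewrite /gaussT /Defs.eta; case: eqVneq => [_|zn0].
  by rewrite lexx ltW.
have {}z0 : 0 < z by rewrite lt_def zn0.
have -> : 1 / z = theta * (1 / (z * theta)) by field; rewrite zn0 lt0r_neq0.
rewrite -mulrBr; have := floor_itv (1 / (z * theta)).
set k := (Num.floor _)%:~R; set e := 1 / _ => /andP[k0 k1].
have t := theta0; rewrite intrD in k1; nra.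
Qed.

Lemma iter_gaussT_itv n t : 0 <= t <= theta -> 0 <= iter n T t <= theta.
Proof. by move=> dt; elim: n => //= n; exact: gaussT_itv. Qed.

Lemma iter_gaussT0 n : iter n T 0 = 0.
Proof. by elim: n => //= n ->; exact: gaussT0. Qed.

(** The points with first digit [i]. *)
Definition branch i : set R := `]1 / (i.+1%:R * theta), 1 / (i%:R * theta)].

Lemma eta_eq i z : (m <= i)%N -> 0 <= z <= theta ->
  Defs.eta theta z = Some (Posz i) <-> branch i z.
Proof.
move=> mi /andP[z0 zt]; have p := digit_theta_gt0 theta0 m_theta2 mi.
have p1 := digit_theta_gt0 theta0 m_theta2 (leq_trans mi (leqnSn i)).
rewrite /Defs.eta /branch /= in_itv/=; case: eqVneq => [->|zn0].
  by split=> //; rewrite ltNge divr_ge0// ltW.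
have {}z0 : 0 < z by rewrite lt_def zn0.
have zt0 : 0 < z * theta by rewrite mulr_gt0.
have e : (Num.floor (1 / (z * theta)) == Posz i) =
    (1 / (i.+1%:R * theta) < z <= 1 / (i%:R * theta)).
  rewrite floor_eq ltr_pdivrMr// ltr_pdivrMr// ler_pdivlMr// ler_pdivlMr//.
  rewrite andbC -[(Posz i)%:~R]/(i%:R) intrD -[(Posz i)%:~R]/(i%:R) natr1.
  by rewrite !mulrA ![_ * z]mulrC -!mulrA.
by split=> [[/eqP]|]; rewrite ?e// -e => /eqP ->.
Qed.

Lemma eta_ge z : 0 < z -> z <= theta -> exists i, Defs.eta theta z = Some (Posz (m + i)).
Proof.
move=> z0 zt; rewrite /Defs.eta gt_eqF//.
have : (Posz m <= Num.floor (1 / (z * theta)))%R.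
  rewrite floor_ge_int_tmp ler_pdivlMr ?mulr_gt0//.
  rewrite -[_%:~R]/(m%:R) -[leRHS]m_theta2 expr2 ler_wpM2l// ler_wpM2r//.
  exact: ltW.
case: (Num.floor _) => // k; rewrite lez_nat => mk.
by exists (k - m)%N; rewrite subnKC.
Qed.

Definition cyl w : set R := [set t | 0 <= t <= theta /\
  forall k, (k < size w)%N -> digit theta k.+1 t = Some (Posz (nth 0%N w k))].

Definition cylT w B : set R := cyl w `&` iter (size w) T @^-1` B.

Lemma cyl_rcons w i :
  cyl (rcons w i) = cyl w `&` [set t | Defs.eta theta (iter (size w) T t) = Some (Posz i)].
Proof.
apply/seteqP; split=> [t [dt h]|t [[dt h] /= e]].
  split; last by have := h (size w); rewrite size_rcons nth_rcons ltnn eqxx; exact.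
  split=> // k kw; have := h k; rewrite size_rcons nth_rcons kw; apply.
  by rewrite ltnS ltnW.
split=> // k; rewrite size_rcons ltnS leq_eqVlt nth_rcons => /predU1P[->|kw].
  by rewrite ltnn eqxx.
by rewrite kw h.
Qed.

Lemma cylT_rcons w i B : (m <= i)%N ->
  cylT (rcons w i) B = cylT w (branch i `&` [set z | B (1 / z - theta * i%:R)]).
Proof.
move=> mi; rewrite /cylT cyl_rcons size_rcons.
apply/seteqP; split=> [t [[ct /= e] Bt]|t [ct /= [bt Bt]]].
- have dz := iter_gaussT_itv (size w) ct.1.
  split => //; split; first exact/eta_eq.
  by move: Bt; rewrite /= {1}/gaussT e.
- have dz := iter_gaussT_itv (size w) ct.1.
  have e : Defs.eta theta (iter (size w) T t) = Some (Posz i) by exact/eta_eq.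
  by split; [split|rewrite /= /gaussT e].
Qed.

Lemma measurable_cylT w B : admissible w -> measurable B -> measurable (cylT w B).
Proof.
elim/last_ind: w B => [|w i IH] B.
  move=> _ mB; rewrite (_ : cylT [::] B = `[0, theta] `&` B).
    by apply: measurableI.
  apply/seteqP; split=> t /=; rewrite /cylT /cyl/= in_itv/=; first by case=> -[].
  by case.
rewrite all_rcons => /andP[mi aw] mB; rewrite cylT_rcons//; apply: IH => //.
have -> : branch i `&` [set z | B (1 / z - theta * i%:R)] =
    branch i `&` (`]0, +oo[ `&` (fun z => 1 / z - theta * i%:R) @^-1` B).
  apply/seteqP; split=> z /=; last by case=> ? [].
  case=> bz Bz; split => //; split => //; move: bz; rewrite /branch/= !in_itv/=.
  rewrite andbT => /andP[+ _]; apply: le_lt_trans.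
  by rewrite divr_ge0// mulr_ge0// ltW.
apply: measurableI; first exact: measurable_itv.
suff mf : measurable_fun (`]0%R, +oo[%classic : set R) (fun z : R => 1 / z - theta * i%:R).
  exact: (mf (measurable_itv _) _ mB).
apply: open_continuous_measurable_fun; first exact: interval_open.
move=> z; rewrite inE/= in_itv/= andbT => z0.
apply: cvgB; last exact: cvg_cst.
by apply: cvgM; [exact: cvg_cst|apply: cvgV; [rewrite gt_eqF|exact: cvg_id]].
Qed.

Lemma u_word_itv w : admissible w -> 0 <= u_word theta w a <= theta.
Proof.
elim/last_ind: w => [//|w i IH]; rewrite all_rcons u_word_rcons => /andP[mi /IH].
move=> /andP[u0 _].
by have /andP[/ltW -> ->] := u_digit_itv theta0 m_theta2 mi u0.
Qed.

Lemma P_word_ge0 w : admissible w -> 0 <= P_word theta w a.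
Proof.
elim/last_ind: w => [|w i IH]; first by rewrite /P_word big_ord0.
rewrite all_rcons P_word_rcons => /andP[mi aw].
by rewrite mulr_ge0 ?IH// P_digit_ge0//; case/andP: (u_word_itv aw).
Qed.

Lemma sn_cyl w t : cyl w t -> sn theta a (size w) t = u_word theta w a.
Proof.
elim/last_ind: w t => [//|w i IH] t; rewrite cyl_rcons => -[ct /= e].
by rewrite size_rcons u_word_rcons /= /digit/= e IH// addrC.
Qed.

Section Measure.
Context (gamma : probability (measurableTypeR R) R) (hgamma : is_gamma theta a gamma).

Let cylT_itv_diff w (V : R -> R) : admissible w ->
  (forall x, 0 <= x <= theta -> gamma (cylT w `[0, x]) = (V x)%:E) ->
  forall x y, 0 <= x -> x <= y -> y <= theta ->
  gamma (cylT w `]x, y]) = (V y - V x)%:E.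
Proof.
move=> aw hV x y x0 xy yt.
have : gamma (cylT w `[0, y]) = (gamma (cylT w `[0%R, x]) + gamma (cylT w `]x, y]))%E.
  rewrite -measureU//; try exact: measurable_cylT.
  - congr (gamma _); rewrite /cylT -setIUr -preimage_setU; congr (_ `&` _ @^-1` _).
    apply/seteqP; split=> z /=; rewrite !in_itv/=.
      by move=> /andP[-> ->]; have [zx|xz] := leP z x; [left|right].
    case=> /andP[z0 zx]; first by rewrite z0 (le_trans zx).
    by rewrite zx (le_trans x0) ?ltW.
  - rewrite /cylT setIACA setIid -preimage_setI.
    rewrite (_ : `[0, x]%classic `&` `]x, y]%classic = set0) ?preimage_set0 ?setI0//.
    apply/seteqP; split=> z //=; rewrite !in_itv/= => -[/andP[_ zx] /andP[xz _]].
    by move: (lt_le_trans xz zx); rewrite ltxx.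
rewrite !hV ?x0 ?yt ?(le_trans x0) ?(le_trans xy)//.
case: (gamma _) => [e| |]//; rewrite -EFinD => -[->].
by rewrite addrAC subrr add0r.
Qed.

(** The conditional law of [T^n] given the first digits.  In the induction the
    event for a further digit is a preimage of an interval whose left endpoint may
    or may not belong to it, so it is squeezed between the half-open interval and
    slightly larger ones, whose measures are known and depend continuously on the
    endpoint. *)
Lemma gamma_cylT w x : admissible w -> 0 <= x <= theta ->
  gamma (cylT w `[0, x]) =
  (P_word theta w a * gamma_cdf theta (u_word theta w a) x)%:E.
Proof.
elim/last_ind: w x => [|w i IH] x.
  move=> _ dx; rewrite /P_word big_ord0 mul1r /u_word /= /gamma_cdf -hgamma//; congr (gamma _).
  apply/seteqP; split=> t; rewrite /cylT /cyl/= in_itv/=; first by case.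
  move=> /andP[t0 tx]; rewrite t0 tx; case/andP: dx => _ xt.
  by rewrite (le_trans tx).
rewrite all_rcons => /andP[mi aw] /andP[x0 xt].
have /andP[u0 ut] := u_word_itv aw; have P0 := P_word_ge0 aw.
rewrite P_word_rcons u_word_rcons -mulrA (gamma_cdf_digit theta0 m_theta2)//.
set u := u_word theta w a in u0 ut *.
set p := 1 / _; set q := 1 / _.
have /andP[q0 qt] := inv_digit_itv theta0 m_theta2 mi x0; rewrite -/q in q0 qt.
have /andP[p0 pt] := inv_digit_itv theta0 m_theta2 mi (lexx 0).
rewrite addr0 -/p in p0 pt.
have k0 := digit_theta_gt0 theta0 m_theta2 mi.
have qp : q <= p by rewrite /q /p !div1r lef_pV2 ?posrE ?ltr_wpDr// lerDl.
have k1 := digit_theta_gt0 theta0 m_theta2 (leq_trans mi (leqnSn i)).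
pose S : set R := branch i `&` [set z | `[0, x]%classic (1 / z - theta * i%:R)].
have invlt (z k : R) : 0 < z -> 0 < k -> (1 / z <= k) = (1 / k <= z).
  by move=> z0' k0'; rewrite !ler_pdivrMr// mulrC.
have Slo : `]q, p] `<=` S.
  move=> z; rewrite /S /branch /= !in_itv/= => /andP[qz zp].
  have z0 := lt_trans q0 qz; rewrite zp andbT; split.
    apply: le_lt_trans qz; rewrite /q !div1r lef_pV2 ?posrE ?ltr_wpDr//.
    by rewrite -natr1 mulrDl mul1r lerD2l.
  rewrite subr_ge0 lerBlDr; apply/andP; split.
    by move: zp; rewrite /p !ler_pdivlMr// [theta * _]mulrC [z * _]mulrC.
  by rewrite [theta * _]mulrC addrC invlt ?ltr_wpDr//; exact: ltW.
have Shi : S `<=` `[q, p].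
  move=> z; rewrite /S /branch /= !in_itv/= => -[/andP[lz zp] /andP[_]].
  have z0 : 0 < z by apply: le_lt_trans lz; rewrite divr_ge0// ltW.
  by rewrite zp andbT lerBlDr [theta * _]mulrC addrC invlt ?ltr_wpDr.
rewrite cylT_rcons// -/S.
have mS : measurable (cylT w S).
  rewrite /S -cylT_rcons//; apply: measurable_cylT => //.
  by rewrite all_rcons mi.
pose V y := P_word theta w a * gamma_cdf theta u y.
have hV y : 0 <= y <= theta -> gamma (cylT w `[0, y]) = (V y)%:E by exact: IH.
have Vdiff := cylT_itv_diff aw hV.
have cylTS (B C : set R) : B `<=` C -> cylT w B `<=` cylT w C.
  by move=> BC t [ct Bt]; split => //; exact: BC.
have lo : ((V p - V q)%:E <= gamma (cylT w S))%E.
  rewrite -Vdiff ?(ltW q0)//; apply: le_measure; rewrite ?inE//.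
    exact: measurable_cylT.
  exact: cylTS.
have hi r : 0 <= r < q -> (gamma (cylT w S) <= (V p - V r)%:E)%E.
  move=> /andP[r0 rq]; rewrite -Vdiff ?(le_trans (ltW rq))//.
  apply: le_measure; rewrite ?inE//; first exact: measurable_cylT.
  apply: cylTS => z /Shi; rewrite /= !in_itv/= => /andP[qz ->].
  by rewrite (lt_le_trans rq).
have [g gE] : exists g, gamma (cylT w S) = g%:E.
  by exists (fine (gamma (cylT w S))); rewrite fineK// fin_num_measure.
rewrite gE in lo hi *; rewrite mulrBr -/(V p) -/(V q); congr EFin.
apply/eqP; rewrite eq_le; apply/andP; split; last by rewrite -lee_fin.
apply/ler_addgt0Pr => e e0.
pose K := P_word theta w a * ((u * theta + 1) / theta).
have K0 : 0 <= K.
  by rewrite /K mulr_ge0// divr_ge0 ?(ltW theta0)// addr_ge0// mulr_ge0// ltW.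
(* [K] is a Lipschitz constant of [V]; the [+ 1] avoids dividing by [0]. *)
pose r := Num.max 0 (q - e / (K + 1)).
have eK : 0 < e / (K + 1) by rewrite divr_gt0// ltr_wpDl.
have dr : 0 <= r < q by rewrite /r le_max lexx/= gt_max q0; lra.
have := hi r dr; rewrite lee_fin => /le_trans; apply.
have /andP[r0 /ltW rq] := dr.
have : V q - V r <= K * (q - r).
  by rewrite /V -mulrBr /K -mulrA ler_wpM2l// gamma_cdf_lip.
have : q - r <= e / (K + 1) by rewrite /r lerBlDr -lerBlDl le_max lexx orbT.
move=> /(ler_wpM2l K0).
have : K * (e / (K + 1)) <= e.
  by rewrite mulrA ler_pdivrMr ?ltr_wpDl//; nra.
lra.
Qed.

Definition cyl_joint w n x y : set R := cyl w `&`
  [set t | 0 <= iter (size w + n) T t <= x /\ 0 <= sn theta a (size w + n) t <= y].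

Lemma cyl_joint0 w x y : admissible w ->
  cyl_joint w 0 x y = if u_word theta w a <= y then cylT w `[0, x] else set0.
Proof.
move=> aw; have /andP[u0 _] := u_word_itv aw.
rewrite /cyl_joint /cylT addn0; apply/seteqP; split=> t.
  by case=> ct /=; rewrite (sn_cyl ct) u0/= => -[? ->]; split => //=; rewrite in_itv.
by case: ifP => //= uy [ct /=]; rewrite in_itv/= (sn_cyl ct) u0 uy; split.
Qed.

Lemma cyl_joint_split w n x y : admissible w -> 0 <= x -> 0 <= y ->
  cyl_joint w n.+1 x y = cylT w `[0, 0] `|` \bigcup_i cyl_joint (rcons w (m + i)%N) n x y.
Proof.
move=> aw x0 y0; apply/seteqP; split=> t.
- move=> [ct /= [dT ds]]; have /andP[] := iter_gaussT_itv (size w) ct.1.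
  rewrite le_eqVlt => /predU1P[z0 _|z0 zt].
    by left; split => //=; rewrite in_itv/= -z0 lexx.
  have [i e] := eta_ge z0 zt; right; exists i => //.
  by split; [rewrite cyl_rcons|rewrite /= size_rcons addSnnS].
- case=> [[ct /=]|[i _ [/=]]].
    rewrite in_itv/= -eq_le eq_sym => /eqP z0; split => //=.
    rewrite addnS /= /digit/= [(size w + n)%N]addnC iterD z0 iter_gaussT0.
    by rewrite gaussT0 /Defs.eta eqxx !lexx.
  rewrite cyl_rcons => -[ct e]; rewrite /= size_rcons addSnnS => h.
  by split.
Qed.

(** The chain property: the joint event inside the cylinder of [w] depends on the
    past only through [u_w(a)].  The next digit splits it countably; the points
    without a next digit form a null set. *)
Lemma gamma_cyl_joint w n x y : admissible w -> 0 <= x <= theta -> 0 <= y ->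
  measurable (cyl_joint w n x y) /\
  gamma (cyl_joint w n x y) = (P_word theta w a *
    iter n U (below theta x true y) (u_word theta w a))%:E.
Proof.
move=> + dx y0; have /andP[x0 _] := dx.
elim: n w => [|n IH] w aw.
  rewrite cyl_joint0// /below/=; case: ifP => _.
    by split; [exact: measurable_cylT|rewrite gamma_cylT].
  by rewrite measure0 mulr0.
have awi i : admissible (rcons w (m + i)%N) by rewrite all_rcons leq_addr.
have mJ i : measurable (cyl_joint (rcons w (m + i)%N) n x y) by have [] := IH _ (awi i).
have mU : measurable (\bigcup_i cyl_joint (rcons w (m + i)%N) n x y).
  exact: bigcup_measurable.
have m0 : measurable (cylT w `[0, 0]) by exact: measurable_cylT.
rewrite cyl_joint_split//; split; first exact: measurableU.
have du := u_word_itv aw.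
rewrite measureU//; last first.
  apply/seteqP; split=> t // -[[ct /=]]; rewrite in_itv/= -eq_le eq_sym => /eqP z0.
  by move=> [i _ [+ _]]; rewrite cyl_rcons => -[_ /=]; rewrite z0 /Defs.eta eqxx.
have g0 : gamma (cylT w `[0, 0]) = 0%E.
  by rewrite gamma_cylT ?lexx ?(ltW theta0)// /gamma_cdf mulr0 mul0r mulr0.
rewrite [X in (X + _)%E]g0 add0e.
have gU : gamma (\bigcup_i cyl_joint (rcons w (m + i)%N) n x y) =
    (\sum_(i <oo) gamma (cyl_joint (rcons w (m + i)%N) n x y))%E.
  apply: measure_semi_bigcup => //.
  apply/trivIsetP => i j _ _ ij; apply/seteqP; split=> t //.
  case=> -[+ _] [+ _]; rewrite !cyl_rcons => -[_ /= ->] [_ /= []] /eqP.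
  by rewrite eqn_add2l (negbTE ij).
rewrite [LHS]gU.
rewrite EFinM /= chainUE//; last by apply: iter_chainU_unit => //; exact: below_unit.
rewrite -nneseriesZl; last first.
  move=> i _; rewrite lee_fin mulr_ge0//.
    by apply: P_digit_ge0 => //; case/andP: du.
  have dv := u_word_itv (awi i); rewrite u_word_rcons in dv.
  by have /andP[] := iter_chainU_unit theta0 m_theta2 n (below_unit theta0 true y dx) dv.
apply: eq_eseriesr => i _; have [_ ->] := IH _ (awi i).
by rewrite P_word_rcons u_word_rcons -EFinM -mulrA.
Qed.

Lemma joint_eventE n x y : joint_event theta a n x y = cyl_joint [::] n x y.
Proof.
apply/seteqP; split=> t; first by case=> dt dT ds; split.
by case=> -[dt _] [dT ds]; split.
Qed.

Lemma gamma_joint n x y : 0 <= x <= theta -> 0 <= y ->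
  gamma (joint_event theta a n x y) = (iter n U (below theta x true y) a)%:E.
Proof.
move=> dx y0; rewrite joint_eventE.
have [_ ->] := @gamma_cyl_joint [::] n x y isT dx y0.
by rewrite /P_word big_ord0 mul1r.
Qed.

Lemma measurable_joint n x y : 0 <= x <= theta -> 0 <= y ->
  measurable (joint_event theta a n x y).
Proof.
move=> dx y0; rewrite joint_eventE.
by have [] := @gamma_cyl_joint [::] n x y isT dx y0.
Qed.

End Measure.
End Cylinders.

(** * The two bounds *)

Section Bounds.
Context {R : realType} (m : nat) (theta : R).
Context (theta0 : 0 < theta) (m_theta2 : m%:R * theta ^+ 2 = 1).
Implicit Types (f h : R -> R) (s r t x y z c k : R) (n : nat).

Notation U := (chainU m theta).

Lemma theta2_le1 : theta ^+ 2 <= 1.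
Proof.
rewrite -[leRHS]m_theta2 ler_peMl ?sqr_ge0//.
by rewrite (ler_nat _ 1) (m_gt0 m_theta2).
Qed.

(** The left side is the sum of the oscillations of the two nondecreasing
    functions in [iter_below_osc].  It is largest at [y = theta], where its
    distance to [1] factors as
    [(theta - x) (1 - theta x) / ((theta x + 1) theta)]. *)
Lemma below_variation x y : 0 <= x <= theta -> 0 <= y <= theta ->
  2 * gamma_cdf theta y x - gamma_cdf theta 0 x <= 1.
Proof.
move=> dx dy; have /andP[x0 xt] := dx; have /andP[y0 yt] := dy.
have := gamma_cdf_mono_l theta0 y0 yt dx.
have t2 := theta2_le1; have tx : theta * x <= 1.
  by apply: le_trans t2; rewrite expr2 ler_wpM2l// ltW.
suff : 2 * gamma_cdf theta theta x - gamma_cdf theta 0 x <= 1 by lra.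
have p : 0 < theta * x + 1 by rewrite ltr_wpDl// mulr_ge0// ltW.
rewrite -subr_ge0 /gamma_cdf.
have -> : 1 - (2 * ((theta * theta + 1) * x / ((theta * x + 1) * theta)) -
   (0 * theta + 1) * x / ((0 * x + 1) * theta)) =
   (theta - x) * (1 - theta * x) / ((theta * x + 1) * theta).
  by field; rewrite !lt0r_neq0.
by rewrite divr_ge0// mulr_ge0 ?subr_ge0// ltW.
Qed.

(** [below] first increases up to [y] and then drops to [0]; it is the function
    stopped at [y] minus a step at [y], both nondecreasing. *)
Lemma iter_below_osc n x y s r : 0 <= x <= theta -> 0 <= y <= theta ->
  0 <= s <= theta -> 0 <= r <= theta ->
  `|iter n U (below theta x true y) s - iter n U (below theta x true y) r|
    <= 1 / m.+1%:R ^+ n.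
Proof.
move=> dx dy ds dr; have /andP[x0 xt] := dx; have /andP[y0 yt] := dy.
(* [f1] is the function stopped at [y], [f2] the step. *)
pose f1 z := gamma_cdf theta (Num.min z y) x.
pose f2 z := if z <= y then 0 else gamma_cdf theta y x.
have g0 : 0 <= gamma_cdf theta y x by exact: gamma_cdf_ge0.
have g1 : gamma_cdf theta y x <= 1 by exact: gamma_cdf_le1.
have u1 : unit_valued theta f1.
  move=> z /andP[z0 zt]; have z1 : 0 <= Num.min z y by rewrite le_min z0.
  by rewrite /f1 gamma_cdf_ge0// gamma_cdf_le1.
have u2 : unit_valued theta f2.
  by move=> z _; rewrite /f2; case: ifP; rewrite ?lexx ?ler01// g0.
have ub := below_unit theta0 true y dx.
have E z : (below theta x true y \+ f2) z = f1 z.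
  rewrite /below /f1 /f2 /=; have [zy|yz] := leP z y.
    by rewrite addr0.
  by rewrite add0r.
have D z : 0 <= z <= theta -> iter n U (below theta x true y) z =
    iter n U f1 z - iter n U f2 z.
  move=> dz; have Efun : below theta x true y \+ f2 = f1 by apply/funext.
  have uE : unit_valued theta (below theta x true y \+ f2) by rewrite Efun.
  by rewrite -Efun (iter_chainUD theta0 m_theta2)// addrK.
have i1 : incr_by theta f1 (gamma_cdf theta y x - gamma_cdf theta 0 x).
  move=> z v z0 zv vt; rewrite /f1.
  have zy0 : 0 <= Num.min z y by rewrite le_min z0.
  have := gamma_cdf_mono_l theta0 zy0 (_ : Num.min z y <= Num.min v y) dx.
  have -> : Num.min z y <= Num.min v y by rewrite le_min !ge_min zv lexx orbT.
  move=> /(_ isT) ->/=; rewrite addrA lerBrDr [leRHS]addrC lerD//.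
    by apply: gamma_cdf_mono_l => //; rewrite ?le_min ?ge_min ?lexx ?orbT// (le_trans z0).
  exact: gamma_cdf_mono_l.
have i2 : incr_by theta f2 (gamma_cdf theta y x).
  move=> z v z0 zv vt; rewrite /f2; case: ifP => zy; case: ifP => vy.
  - by rewrite lexx add0r.
  - by rewrite g0 add0r lexx.
  - by move: (le_trans zv vy); rewrite zy.
  - by rewrite lexx lerDl.
have o1 := iter_chainU_osc theta0 m_theta2 n u1 i1 ds dr.
have o2 := iter_chainU_osc theta0 m_theta2 n u2 i2 ds dr.
have bv := below_variation dx dy.
have e0 : 0 <= (m.+1%:R ^+ n)^-1 :> R by rewrite invr_ge0 exprn_ge0.
rewrite !D// div1r; move: o1 o2 (ler_wpM2r e0 bv); rewrite !ler_norml.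
set e := (_ ^+ n)^-1; set v1 := iter n U f1 s; set v2 := iter n U f1 r.
set w1 := iter n U f2 s; set w2 := iter n U f2 r; rewrite !mulrBl mul1r.
rewrite -(mulrA 2); set p := gamma_cdf theta y x * e; set q := gamma_cdf theta 0 x * e.
lra.
Qed.

Lemma gaussE_le f k : unit_valued theta f -> measurable_fun `[0, theta] f -> 0 <= k ->
  (forall s, 0 <= s <= theta -> f s <= k) -> (gaussE theta f <= k%:E)%E.
Proof.
move=> f1 mf k0 fk.
have -> : k%:E = (k%:E * gaussE theta (fun=> 1%R))%E by rewrite gaussE_cst1// mule1.
have mg := measurable_gauss_density theta0.
rewrite /gaussE -ge0_integralZl_EFin//.
- apply: ge0_le_integral => //.
  + move=> s; rewrite /= in_itv/= => ds; have /andP[f0 _] := f1 s ds.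
    by rewrite lee_fin mulr_ge0// gauss_density_ge0//; case/andP: ds.
  + by apply/measurable_EFinP; apply: measurable_funM.
  + apply/measurable_EFinP; apply: measurable_funM; first exact: measurable_cst.
    by apply: measurable_funM.
  + move=> s; rewrite /= in_itv/= => ds; rewrite -EFinM lee_fin mul1r.
    by rewrite ler_wpM2r ?fk// gauss_density_ge0//; case/andP: ds.
- move=> s; rewrite /= in_itv/= => /andP[s0 _].
  by rewrite lee_fin mul1r gauss_density_ge0.
- by apply/measurable_EFinP; apply: measurable_funM.
Qed.

(** A function is as close to its mean as it oscillates; the lower half is the
    upper half for [1 - f]. *)
Lemma gaussE_near f d (k : R) s : unit_valued theta f -> measurable_fun `[0, theta] f ->
  (forall r, 0 <= r <= theta -> `|f s - f r| <= d) -> 0 <= s <= theta ->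
  gaussE theta f = k%:E -> `|f s - k| <= d.
Proof.
move=> f1 mf osc ds fk.
have d0 : 0 <= d by apply: le_trans (osc s ds); exact: normr_ge0.
have /andP[fs0 fs1] := f1 s ds.
have up : k <= f s + d.
  rewrite -lee_fin -fk; apply: gaussE_le => //; first by rewrite addr_ge0.
  by move=> r dr; have := osc r dr; rewrite ler_norml; lra.
have uc := unit_valued_compl f1.
have mc : measurable_fun `[0, theta] (fun s => 1 - f s).
  by apply: measurable_funB => //; exact: measurable_cst.
have ck : gaussE theta (fun s => 1 - f s) = (1 - k)%:E.
  have := gaussED theta0 f1 uc mf mc.
  have -> : f \+ (fun s => 1 - f s) = fun=> 1.
    by apply/funext => r; rewrite /= addrC subrK.
  rewrite gaussE_cst1// fk; case: (gaussE _ _) => [e| |]//.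
  by rewrite -EFinD => -[->]; rewrite addrAC subrr add0r.
have lo : 1 - k <= (1 - f s) + d.
  rewrite -lee_fin -ck; apply: gaussE_le => //; first by rewrite addr_ge0// subr_ge0.
  by move=> r dr; have := osc r dr; rewrite ler_norml; lra.
rewrite ler_norml; lra.
Qed.

Lemma iter_below_near n x y s : 0 <= x <= theta -> 0 <= y <= theta ->
  0 <= s <= theta ->
  `|iter n U (below theta x true y) s - ln (1 + x * y) / ln (1 + theta ^+ 2)|
    <= 1 / m.+1%:R ^+ n.
Proof.
move=> dx dy ds; have /andP[x0 _] := dx.
have ub := below_unit theta0 true y dx.
apply: gaussE_near => //.
- exact: iter_chainU_unit.
- by apply: measurable_iter_chainU => //; exact: measurable_below.
- by move=> r dr; exact: iter_below_osc.
- by rewrite gaussE_iter_below// /limit_cdf clamp_id.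
Qed.

Lemma P_digit_m s : 0 <= s -> P_digit theta m s = theta / (s + m.+1%:R * theta).
Proof.
move=> s0; have p := digit_theta_gt0 theta0 m_theta2 (leqnn m).
have p1 := digit_theta_gt0 theta0 m_theta2 (leqnSn m).
have sp : 0 < s + m%:R * theta by rewrite ltr_wpDl.
have sp1 : 0 < s + m.+1%:R * theta by rewrite ltr_wpDl.
rewrite /P_digit.
have -> : s * theta + 1 = theta * (s + m%:R * theta).
  by transitivity (s * theta + m%:R * theta ^+ 2); [rewrite m_theta2|ring].
move: (s + m%:R * theta) sp (s + m.+1%:R * theta) sp1 => x x0 y y0.
by field; rewrite !lt0r_neq0.
Qed.

(** After the factor [t - s] this reduces to
    [theta <= c (s + m theta) (t + m theta)], which holds as [(m theta)^2 = m >= 1]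
    and [c >= theta]. *)
Lemma u_digit_m_harnack s t : 0 <= s -> s <= t ->
  let c := m.+1%:R * theta in
  (u_digit theta m s + c) * (s + c) <= (u_digit theta m t + c) * (t + c).
Proof.
move=> s0 st /=; have t0 := le_trans s0 st.
have p := digit_theta_gt0 theta0 m_theta2 (leqnn m).
have h := digit_scale m_theta2 (leqnn m); have th := theta0.
have sp : 0 < s + m%:R * theta by rewrite ltr_wpDl.
have tp : 0 < t + m%:R * theta by rewrite ltr_wpDl.
have -> : m.+1%:R * theta = m%:R * theta + theta by rewrite -natr1 mulrDl mul1r.
set A := m%:R * theta in p sp tp *.
have A1 : 1 <= A ^+ 2.
  rewrite /A exprMn expr2 -mulrA m_theta2 mulr1.
  by rewrite (ler_nat _ 1) (m_gt0 m_theta2).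
rewrite -subr_ge0 /u_digit -/A.
have -> : (1 / (t + A) + (A + theta)) * (t + (A + theta)) -
   (1 / (s + A) + (A + theta)) * (s + (A + theta)) =
   (t - s) * ((A + theta) * ((s + A) * (t + A)) - theta) / ((s + A) * (t + A)).
  by field; rewrite !lt0r_neq0.
rewrite divr_ge0 ?mulr_ge0 ?subr_ge0//; try exact: ltW.
have : 1 <= (s + A) * (t + A).
  apply: (le_trans A1); rewrite expr2 ler_pM ?lerDr//; exact: ltW.
nra.
Qed.

(** With [c = (m + 1) theta] one has [P_m(s) = theta / (s + c)], so each half of
    the statement for [n + 1] follows from the other half for [n] at the points
    [u_m(t) <= u_m(s)]. *)
Lemma P_word_nseqm_harnack n s t : 0 <= s -> s <= t ->
  let c := m.+1%:R * theta in
  P_word theta (nseq n m) t <= P_word theta (nseq n m) s /\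
  (s + c) * P_word theta (nseq n m) s <= (t + c) * P_word theta (nseq n m) t.
Proof.
move=> + + c; have c0 : 0 < c := digit_theta_gt0 theta0 m_theta2 (leqnSn m).
elim: n s t => [|n IH] s t s0 st; have t0 := le_trans s0 st.
  by rewrite /P_word !big_ord0 lexx !mulr1 lerD2r.
rewrite /= !P_word_cons !P_digit_m// -/c.
have /andP[/ltW us _] := u_digit_itv theta0 m_theta2 (leqnn m) s0.
have /andP[/ltW ut _] := u_digit_itv theta0 m_theta2 (leqnn m) t0.
have [dec inc] := IH _ _ ut (u_digit_anti theta0 m_theta2 (leqnn m) s0 st).
have sc : 0 < s + c by rewrite ltr_wpDl.
have tc : 0 < t + c by rewrite ltr_wpDl.
have uc : 0 < u_digit theta m t + c by rewrite ltr_wpDl.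
have Q0 : 0 <= P_word theta (nseq n m) (u_digit theta m s).
  apply: (P_word_ge0 theta0 m_theta2 (a := u_digit theta m s)); last by rewrite all_nseq leqnn orbT.
  by have /andP[_ ->] := u_digit_itv theta0 m_theta2 (leqnn m) s0; rewrite us.
have H := u_digit_m_harnack s0 st; rewrite /= -/c in H.
set Qs := P_word _ _ (u_digit theta m s) in dec inc Q0 *.
set Qt := P_word _ _ (u_digit theta m t) in dec inc *.
have key : Qt * (s + c) <= (t + c) * Qs.
  rewrite -(ler_pM2l uc).
  by have := ler_wpM2r (ltW sc) inc; have := ler_wpM2r Q0 H; lra.
split.
  have -> : theta / (t + c) * Qt = theta * (Qt * (s + c)) / ((s + c) * (t + c)).
    by field; rewrite !lt0r_neq0.
  have -> : theta / (s + c) * Qs = theta * ((t + c) * Qs) / ((s + c) * (t + c)).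
    by field; rewrite !lt0r_neq0.
  rewrite ler_wpM2r ?invr_ge0 ?mulr_ge0 ?(ltW sc) ?(ltW tc)//.
  by rewrite ler_wpM2l ?(ltW theta0).
have -> : (s + c) * (theta / (s + c) * Qs) = theta * Qs by field; rewrite lt0r_neq0.
have -> : (t + c) * (theta / (t + c) * Qt) = theta * Qt by field; rewrite lt0r_neq0.
by rewrite ler_wpM2l ?(ltW theta0).
Qed.

Lemma P_word_nseqm_le n s : 0 <= s <= theta ->
  P_word theta (nseq n m) theta <= P_word theta (nseq n m) s.
Proof. by move=> /andP[s0 st]; have [] := P_word_nseqm_harnack n s0 st. Qed.

Section Jump.
Context (a : R) (a_itv : 0 <= a <= theta).
Context (gamma : probability (measurableTypeR R) R) (hgamma : is_gamma theta a gamma).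

Lemma u_word_gt0 w : w != [::] -> all (leq m) w -> 0 < u_word theta w a.
Proof.
elim/last_ind: w => // w i _ _; rewrite all_rcons u_word_rcons => /andP[mi aw].
have /andP[u0 _] := u_word_itv theta0 m_theta2 a_itv aw.
by have /andP[] := u_digit_itv theta0 m_theta2 mi u0.
Qed.

(** On the cylinder of [w] the variable [s_n] is constantly [u_w(a)], so this
    cylinder lies in the joint event exactly from the threshold [u_w(a)] on. *)
Lemma joint_jump w y : all (leq m) w -> 0 <= y < u_word theta w a ->
  (gamma (joint_event theta a (size w) theta y) + (P_word theta w a)%:E <=
   gamma (joint_event theta a (size w) theta (u_word theta w a)))%E.
Proof.
move=> aw /andP[y0 yu]; have du := u_word_itv theta0 m_theta2 a_itv aw.
have /andP[u0 ut] := du; have dt : 0 <= theta <= theta by rewrite lexx ltW.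
have <- : gamma (cylT theta w `[0, theta]) = (P_word theta w a)%:E.
  by rewrite (gamma_cylT theta0 m_theta2 a_itv hgamma)// gamma_cdf_theta// mulr1.
have mC : measurable (cylT theta w `[0, theta]) by exact: (measurable_cylT theta0 m_theta2).
have mJ z : 0 <= z -> measurable (joint_event theta a (size w) theta z).
  by move=> z0; exact: (measurable_joint theta0 m_theta2 a_itv hgamma).
rewrite -measureU//; last 2 first.
- exact: mJ.
- apply/seteqP; split=> t // -[[_ _ /andP[_ sy]] [/sn_cyl e _]].
  by move: sy; rewrite e leNgt yu.
apply: le_measure; rewrite ?inE; [|exact: mJ|].
  by apply: measurableU => //; exact: mJ.
move=> t [[d1 d2 /andP[s0 sy]]|[ct /=]].
  by split => //; rewrite s0 (le_trans sy)// ltW.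
by rewrite in_itv/= => dT; split; [exact: ct.1|exact: dT|rewrite (sn_cyl a ct) u0 lexx].
Qed.

End Jump.
End Bounds.

Theorem theorem4p4 (R : realType) (m : nat) (theta : R)
    (hm : (1 <= m)%N) (htheta01 : 0 < theta < 1)
    (htheta_irr : irrational theta) (htheta : theta ^+ 2 = 1 / m%:R)
    (a : R) (ha : 0 <= a <= theta)
    (gamma : probability (measurableTypeR R) R) (hgamma : is_gamma theta a gamma)
    (n : nat) (hn : (1 <= n)%N) :
  let discrepancy : \bar R :=
    ereal_sup [set z | exists x y : R,
      [/\ 0 <= x <= theta, 0 <= y <= theta &
          z = `|gamma (joint_event theta a n x y) -
                (ln (1 + x * y) / ln (1 + theta ^+ 2))%:E|%E ]] in
  ((1 / 2 * P_word theta (nseq n m) theta)%:E <= discrepancy)%E /\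
  (discrepancy <= (1 / m.+1%:R ^+ n)%:E)%E.
Proof.
have /andP[theta0 _] := htheta01.
have m_theta2 : m%:R * theta ^+ 2 = 1.
  by rewrite htheta mulrA mulr1 divff// pnatr_eq0 -lt0n.
have dt : 0 <= theta <= theta by rewrite lexx ltW.
pose F x y : R := ln (1 + x * y) / ln (1 + theta ^+ 2).
pose Phi x y := iter n (chainU m theta) (below theta x true y) a.
have gE x y : 0 <= x <= theta -> 0 <= y <= theta ->
    gamma (joint_event theta a n x y) = (Phi x y)%:E.
  by move=> dx /andP[y0 _]; exact: gamma_joint.
move=> discrepancy.
have upper : (discrepancy <= (1 / m.+1%:R ^+ n)%:E)%E.
  apply: ge_ereal_sup => _ [x [y [dx dy ->]]].
  by rewrite gE// -EFinB abse_EFin lee_fin; exact: iter_below_near.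
split => //.
have dge x y : 0 <= x <= theta -> 0 <= y <= theta ->
    ((`|Phi x y - F x y|)%:E <= discrepancy)%E.
  move=> dx dy; apply: ereal_sup_ubound; exists x, y; split => //.
  by rewrite gE// -EFinB abse_EFin.
move: upper dge; case: discrepancy => [d| |] //; last first.
  by move=> _ /(_ _ _ dt dt).
move=> _ dge; rewrite lee_fin.
pose w := nseq n m.
have aw : all (leq m) w by rewrite all_nseq leqnn orbT.
have sw : size w = n by rewrite size_nseq.
have wn0 : w != [::] by rewrite -size_eq0 sw -lt0n.
pose y0 := u_word theta w a.
have dy0 : 0 <= y0 <= theta := u_word_itv theta0 m_theta2 ha aw.
have y0_gt0 : 0 < y0 by exact: (u_word_gt0 theta0 m_theta2 ha wn0 aw).
have L0 : 0 < ln (1 + theta ^+ 2) :> R by exact: gauss_const_gt0.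
have jump y : 0 <= y < y0 -> Phi theta y + P_word theta w a <= Phi theta y0.
  move=> /andP[y1 yy0]; have := joint_jump theta0 m_theta2 ha hgamma aw (y := y).
  rewrite sw -/y0 !gE//; last by rewrite y1 (le_trans (ltW yy0))//; case/andP: dy0.
  by rewrite -EFinD lee_fin; apply; rewrite y1.
have Flip y : 0 <= y < y0 -> F theta y0 - F theta y <= theta / ln (1 + theta ^+ 2) * (y0 - y).
  move=> /andP[y1 yy0]; have ty : 0 <= theta * y by rewrite mulr_ge0// ltW.
  have ty0 : 0 <= theta * y0 by rewrite mulr_ge0// ltW.
  rewrite /F -mulrBl mulrAC ler_wpM2r ?invr_ge0 ?(ltW L0)//.
  rewrite -ln_div ?posrE ?ltr_wpDr//.
  have -> : (1 + theta * y0) / (1 + theta * y) =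
      1 + theta * (y0 - y) / (1 + theta * y).
    by field; rewrite lt0r_neq0// ltr_wpDr.
  have q0 : 0 <= theta * (y0 - y) by rewrite mulr_ge0 ?subr_ge0// ltW.
  apply: (le_trans (le_ln1Dx _)).
    by rewrite (@lt_le_trans _ _ 0)// divr_ge0// addr_ge0.
  by rewrite ler_pdivrMr ?ltr_wpDr// ler_peMr// lerDl.
have Pw := P_word_nseqm_le theta0 m_theta2 n ha; rewrite -/w in Pw *.
(* The jump is at most the sum of the discrepancies on its two sides. *)
suff : P_word theta w a <= 2 * d by lra.
apply/ler_addgt0Pr => e e0.
pose K := theta / ln (1 + theta ^+ 2); have K0 : 0 < K by rewrite divr_gt0.
(* [K] is a Lipschitz constant of the limit, so the limit moves by at most [e]
   between [y] and the jump at [y0]. *)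
pose y := Num.max 0 (y0 - e / K).
have eK : 0 < e / K by rewrite divr_gt0.
have dy : 0 <= y < y0 by rewrite /y le_max lexx/= gt_max y0_gt0 gtrBl.
have dy' : 0 <= y <= theta.
  case/andP: dy => -> /ltW /le_trans; apply; by case/andP: dy0.
have h1 := jump _ dy; have h2 := Flip _ dy.
have h3 : K * (y0 - y) <= e.
  rewrite mulrC -ler_pdivlMr// lerBlDr -lerBlDl.
  by rewrite /y le_max lexx orbT.
have := dge _ _ dt dy0; have := dge _ _ dt dy'.
rewrite !lee_fin !ler_norml; rewrite -/K in h2; lra.
Qed.
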